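(* Let $(\mathbb{X},\mathbb{U},\mathcal{T},c)$ be an MDP and, for a finite set $\Lambda\subset\mathbb{U}$, let $\rho_{\mathbb{U}}$ and $\rho_\Lambda$ be the optimal average costs of the MDPs $(\mathbb{X},\mathbb{U},\mathcal{T},c)$ and $(\mathbb{X},\Lambda,\mathcal{T},c)$, and let $\mathcal{E}(\Lambda)=\sup_{u\in\mathbb{U}}\min_{\hat u\in\Lambda}d_{\mathbb{U}}(u,\hat u)$. Let $D$ be the diameter of $\mathbb{X}$. With the conditions defined in the context, the following hold. (i) Under the Minorization Condition (with measure $\nu$ such that $\kappa:=1-\nu(\mathbb{X})>0$) and the Weak Continuity Condition, $\rho_\Lambda\to\rho_{\mathbb{U}}$ as $\mathcal{E}(\Lambda)\to0$. (ii) Under the Lipschitz Condition, if $K_{\mathcal{T}}<1$, then $$\rho_\Lambda-\rho_{\mathbb{U}}\le\frac{K_c}{1-K_{\mathcal{T}}}\,\mathcal{E}(\Lambda).$$ (iii) Under the Minorization Condition (with measure $\nu$ such that $\kappa:=1-\nu(\mathbb{X})>0$) and the Lipschitz Condition, for every $\delta\in(0,1]$ such that $K_{\mathcal{T}}<\left(\frac1\kappa\right)^{\frac{1-\delta}{\delta}}$, $$\rho_\Lambda-\rho_{\mathbb{U}}\le\frac{K_cD^{1-\delta}}{1-\kappa\left(\frac{K_{\mathcal{T}}}{\kappa}\right)^{\delta}}\,\mathcal{E}(\Lambda)^{\delta}.$$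
   Context: MDP. $(\mathbb{X},d_{\mathbb{X}})$ and $(\mathbb{U},d_{\mathbb{U}})$ are complete separable metric spaces (states and actions), $\mathcal{T}(dx_1|x,u)$ is a stochastic kernel on $\mathbb{X}$ given $\mathbb{X}\times\mathbb{U}$, $c:\mathbb{X}\times\mathbb{U}\to\mathbb{R}$ is a measurable one-stage cost. Admissible policies are (possibly randomized) history-dependent measurable policies. The optimal average cost from $x$ is $\inf_\pi\limsup_{T\to\infty}\frac1TE_x^\pi\left[\sum_{t=0}^{T-1}c(X_t,U_t)\right]$, the infimum being over admissible policies with actions in the given action set ($\mathbb{U}$ or $\Lambda$). In each of the cases considered, this value does not depend on the initial state; it is denoted $\rho_{\mathbb{U}}$, respectively $\rho_\Lambda$. Minorization Condition: there is a positive measure $\nu$ on $\mathbb{X}$ with $\nu(\mathbb{X})>0$ and $\mathcal{T}(B|x,u)\ge\nu(B)$ for all Borel $B\subset\mathbb{X}$ and all $(x,u)\in\mathbb{X}\times\mathbb{U}$. Weak Continuity Condition: $c$ is bounded and continuous; $\mathcal{T}(\cdot|x,u)$ is weakly continuous in $(x,u)$ (i.e. $\mathcal{T}(\cdot|x_n,u_n)\to\mathcal{T}(\cdot|x,u)$ weakly whenever $(x_n,u_n)\to(x,u)$); $\mathbb{U}$ and $\mathbb{X}$ are compact. Lipschitz Condition: $\mathbb{X}$ and $\mathbb{U}$ are compact and there are finite constants $K_c,K_{\mathcal{T}}$ such that for all $x,x',u,u'$: $|c(x,u)-c(x',u')|\le K_c(d_{\mathbb{X}}(x,x')+d_{\mathbb{U}}(u,u'))$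 and $W_1(\mathcal{T}(\cdot|x,u),\mathcal{T}(\cdot|x',u'))\le K_{\mathcal{T}}(d_{\mathbb{X}}(x,x')+d_{\mathbb{U}}(u,u'))$, where $W_1$ is the first-order Wasserstein distance.
   Formalization: In (iii), D^{1-δ} is replaced by max(D, E(Λ))^{1-δ}; the bound as stated fails when E(Λ) > D and δ < 1 (e.g. one-point X, U={0,1}, c=u, Λ={1}, δ=1/2). The two bounds agree whenever E(Λ) ≤ D or δ = 1. *)

(* Defs.v *)
(* MathComp-Analysis *)
From HB Require Import structures.
From mathcomp Require Import all_boot all_order all_algebra.
From mathcomp Require Import all_classical all_reals all_analysis.
From mathcomp Require Import measurable_realfun.

Set Implicit Arguments.
Unset Strict Implicit.
Unset Printing Implicit Defensive.
Import Order.TTheory GRing.Theory Num.Theory.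
Import numFieldNormedType.Exports.

Local Open Scope classical_set_scope.
Local Open Scope ring_scope.

(* Complete separable metric space with its Borel sigma-algebra; the point
   carried by measurable types makes it nonempty. *)
HB.mixin Record isPolishBorel (d : measure_display) (R : realType) T
    & Measurable d T & Metric R T := {
  polish_cauchy_cvg :
    forall F : set_system T, ProperFilter F -> cauchy F -> cvg F ;
  polish_separable : exists2 S : set T, countable S & dense S ;
  polish_borel : (measurable : set (set T)) = <<s open >> }.

#[short(type="polishType")]
HB.structure Definition PolishBorel (d : measure_display) (R : realType) :=
  { T of Measurable d T & Metric R T & isPolishBorel d R T }.

Section metric_notions.
Context (R : realType) (dX : measure_display) (X : polishType dX R).

(* [sup] and [inf] are the real-valued ones: they return junk on unbounded or
   empty sets, and are only used below on compact spaces, with [L] finite and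
   nonempty (so that the infimum over [L] is a minimum). *)
Definition diameter : R :=
  sup [set r | exists x y : X, r = mdist x y].

Definition covering_radius (L : set X) : R :=
  sup [set inf [set mdist u v | v in L] | u in [set: X]].

Definition weak_cvg (mu_ : nat -> {measure set X -> \bar R})
    (mu : {measure set X -> \bar R}) : Prop :=
  forall f : X -> R, continuous f -> (exists M : R, forall x, `|f x| <= M) ->
    (\int[mu_ n]_x (f x)%:E)%E @[n --> \oo] --> (\int[mu]_x (f x)%:E)%E.

Definition coupling (mu nu : {measure set X -> \bar R})
    (g : probability (X * X)%type R) : Prop :=
  forall A : set X, measurable A ->
    g (A `*` setT) = mu A /\ g (setT `*` A) = nu A.

Definition wasserstein1 (mu nu : {measure set X -> \bar R}) : \bar R :=
  ereal_inf [set (\int[g]_z (mdist z.1 z.2)%:E)%E | g in coupling mu nu].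

End metric_notions.
Arguments diameter {R dX} X.

Section mdp.
Context (R : realType) (dX dU : measure_display)
  (X : polishType dX R) (U : polishType dU R).

(* ((x_0,u_0), ..., (x_{t-1},u_{t-1})) and the current state x_t *)
Definition history (t : nat) := (t.-tuple (X * U) * X)%type.

Definition policy := forall t, R.-pker (history t) ~> U.

(* policies whose actions belong to [L] at every stage, whatever the past *)
Definition admissible (L : set U) : set policy :=
  [set pi : policy | forall t h, pi t h L = 1%E].

Definition next_history t (z : history t * U * X) : history t.+1 :=
  ([tuple of rcons z.1.1.1 (z.1.1.2, z.1.2)], z.2).

Lemma measurable_next_history t :
  measurable_fun [set: history t * U * X] (@next_history t).
Proof.
apply: measurable_fun_pair => //=.
apply/measurable_fun_tnthP => i.
have [it|ti] := ltnP i t.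
  rewrite (_ : _ \o _ = (fun p => tnth p (Ordinal it)) \o fst \o fst \o fst).
    apply: measurableT_comp => //; apply: measurableT_comp => //.
    by apply: measurableT_comp => //; exact: measurable_tnth.
  apply/funext => z /=.
  by rewrite !(tnth_nth (z.1.1.2, z.1.2)) /= nth_rcons size_tuple it.
rewrite (_ : _ \o _ = fun z : history t * U * X => (z.1.1.2, z.1.2)).
  apply: measurable_fun_pair => /=.
    by apply: measurableT_comp => //; apply: measurableT_comp.
  by apply: measurableT_comp.
apply/funext => z /=.
have -> : i = ord_max by apply/val_inj/eqP; rewrite eqn_leq ti -ltnS ltn_ord.
by rewrite (tnth_nth (z.1.1.2, z.1.2)) /= nth_rcons size_tuple ltnn eqxx.
Qed.

Definition initial_history (x : X) : history 0 := ([tuple], x).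

Lemma measurable_initial_history : measurable_fun [set: X] initial_history.
Proof. by apply: measurable_fun_pair => //; exact: measurable_cst. Qed.

Section law.
Context (T : R.-pker (X * U) ~> X).

Section transition.
Variable t : nat.

Definition next_state (hu : history t * U) : {measure set X -> \bar R} :=
  T (hu.1.2, hu.2).

Let measurable_next_state A : measurable A ->
  measurable_fun [set: history t * U] (next_state ^~ A).
Proof.
move=> mA; apply: (measurableT_comp (measurable_kernel T _ mA)).
by apply: measurable_fun_pair => //; exact: measurableT_comp.
Qed.

HB.instance Definition _ := isKernel.Build _ _ _ _ _ next_state
  measurable_next_state.

Let next_state_prob hu : next_state hu setT = 1%E.
Proof. exact: prob_kernel. Qed.

HB.instance Definition _ := Kernel_isProbability.Build _ _ _ _ _ next_state
  next_state_prob.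

Definition history_trans (hu : history t * U) (A : set (history t.+1)) :
    \bar R :=
  next_state hu [set y | A (next_history (hu, y))].

Let msec hu (A : set (history t.+1)) : measurable A ->
  measurable [set y | A (next_history (hu, y))].
Proof.
move=> mA; rewrite -[X in measurable X]setTI.
exact: (measurableT_comp (@measurable_next_history t) (pair1_measurable hu)).
Qed.

Let history_trans0 hu : history_trans hu set0 = 0%E.
Proof. by rewrite /history_trans measure0. Qed.

Let history_trans_ge0 hu A : (0 <= history_trans hu A)%E.
Proof. exact: measure_ge0. Qed.

Let history_trans_sigma_additive hu : semi_sigma_additive (history_trans hu).
Proof.
move=> F mF tF mUF.
rewrite /history_trans (_ : [set y | _] =
  \bigcup_i [set y | F i (next_history (hu, y))])//.
apply: (@measure_semi_sigma_additive _ _ _ (next_state hu)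
  (fun i => [set y | F i (next_history (hu, y))])).
- by move=> i; exact: msec.
- apply/trivIsetP => i j _ _ ij; rewrite -subset0 => y [Fi Fj].
  move/trivIsetP : tF => /(_ i j Logic.I Logic.I ij) Fij.
  have : (F i `&` F j) (next_history (hu, y)) by [].
  by rewrite Fij.
- exact: (msec hu mUF).
Qed.

HB.instance Definition _ hu := isMeasure.Build _ _ R (history_trans hu)
  (history_trans0 hu) (history_trans_ge0 hu)
  (@history_trans_sigma_additive hu).

Definition history_trans_kernel :
  history t * U -> {measure set history t.+1 -> \bar R} := history_trans.

Let measurable_history_trans A : measurable A ->
  measurable_fun [set: history t * U] (history_trans_kernel ^~ A).
Proof.
move=> mA; pose B := @next_history t @^-1` A.
rewrite (_ : _ ^~ _ = fun hu => next_state hu (xsection B hu)); last first.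
  by apply/funext => hu; rewrite xsectionE.
apply: measurable_fun_xsection_finite_kernel.
rewrite inE -[X in measurable X]setTI.
exact: measurable_next_history.
Qed.

HB.instance Definition _ := isKernel.Build _ _ _ _ _ history_trans_kernel
  measurable_history_trans.

Let history_trans_prob hu : history_trans_kernel hu setT = 1%E.
Proof. by rewrite -(next_state_prob hu). Qed.

HB.instance Definition _ := Kernel_isProbability.Build _ _ _ _ _
  history_trans_kernel history_trans_prob.

Variable pi : policy.

Definition history_step : history t -> {measure set history t.+1 -> \bar R} :=
  (pi t \; history_trans_kernel)%E.

Let measurable_history_step A : measurable A ->
  measurable_fun [set: history t] (history_step ^~ A).
Proof. exact: measurable_fun_mkcomp_sfinite. Qed.

HB.instance Definition _ := isKernel.Build _ _ _ _ _ history_step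
  measurable_history_step.

Let history_step_prob h : history_step h setT = 1%E.
Proof.
rewrite /history_step /= /kcomp -[RHS](prob_kernel (s := pi t) h).
rewrite -[RHS]mul1e -integral_cst//.
by apply: eq_integral => u _; exact: history_trans_prob.
Qed.

HB.instance Definition _ := Kernel_isProbability.Build _ _ _ _ _
  history_step history_step_prob.

End transition.

Variable pi : policy.

(* law of the history (x_0, u_0, ..., u_{t-1}, x_t) under [pi], as a kernel in
   the initial state *)
Fixpoint history_law t : R.-spker X ~> history t :=
  match t with
  | 0 => kdirac measurable_initial_history
  | t.+1 => mkcomp_noparam (history_law t) (@history_step t pi)
  end.

Lemma history_law_prob t x : history_law t x setT = 1%E.
Proof.
elim: t => [|t IH]; first by rewrite /= diracT.
rewrite -[RHS]IH /= /kcomp_noparam -[RHS]mul1e -integral_cst//.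
by apply: eq_integral => h _; exact: prob_kernel.
Qed.

(* The total cost over the stages t < n only involves the first n state-action
   pairs, so that its expectation is taken under the law of the history at
   time n; no measure on infinite trajectories is needed. *)
Definition average_cost (c : X * U -> R) (x : X) : \bar R :=
  limn_esup (fun n => (n%:R^-1)%:E *
    \int[history_law n x]_h (\sum_(t < n) c (tnth h.1 t))%:E)%E.

End law.

Definition optimal_cost (T : R.-pker (X * U) ~> X) (c : X * U -> R)
    (L : set U) (x : X) : \bar R :=
  ereal_inf [set average_cost T pi c x | pi in admissible L].

(* [r] is the optimal average cost, which has to be real and independent of
   the initial state *)
Definition is_optimal_cost (T : R.-pker (X * U) ~> X) (c : X * U -> R)
    (L : set U) (r : R) : Prop :=
  forall x, optimal_cost T c L x = r%:E.

Definition minorization (T : R.-pker (X * U) ~> X)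
    (nu : {measure set X -> \bar R}) : Prop :=
  (0 < nu setT)%E /\
  forall (A : set X) x u, measurable A -> (nu A <= T (x, u) A)%E.

Definition weak_continuity (T : R.-pker (X * U) ~> X) (c : X * U -> R) : Prop :=
  [/\ (exists M : R, forall z, `|c z| <= M),
      continuous c,
      (forall (x_ : nat -> X) (u_ : nat -> U) x u,
         x_ @ \oo --> x -> u_ @ \oo --> u ->
         weak_cvg (fun n => T (x_ n, u_ n)) (T (x, u))),
      compact [set: U] & compact [set: X]].

Definition lipschitz_condition (T : R.-pker (X * U) ~> X) (c : X * U -> R)
    (Kc KT : R) : Prop :=
  [/\ compact [set: X], compact [set: U],
      (forall x x' u u',
         `|c (x, u) - c (x', u')| <= Kc * (mdist x x' + mdist u u')) &
      (forall x x' u u',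
         (wasserstein1 (T (x, u)) (T (x', u'))
            <= (KT * (mdist x x' + mdist u u'))%:E)%E)].

End mdp.

(* Main.v *)
Require Import Defs.
From HB Require Import structures.
From mathcomp Require Import all_boot all_order all_algebra.
From mathcomp Require Import finmap.
From mathcomp Require Import all_classical all_reals all_analysis.
From mathcomp Require Import measurable_realfun.
From mathcomp Require Import ring lra.

Set Implicit Arguments.
Unset Strict Implicit.
Unset Printing Implicit Defensive.
Import Order.TTheory GRing.Theory Num.Theory.
Import numFieldNormedType.Exports.

Local Open Scope classical_set_scope.
Local Open Scope ring_scope.

(** The whole argument rests on the average cost optimality equation
    [rho + v x = inf_u (c (x, u) + \int v dT(x, u))], of which only approximate
    solutions are ever used.  If a bounded [v] satisfies it up to [e] over the
    action set [L], then along every policy with actions in [L] the expected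
    total cost plus [v] of the current state grows by at least [rho - e] per
    stage, and along a policy that picks nearly minimizing actions it grows by
    at most [rho + e]; the boundary terms are bounded, hence the optimal average
    cost from every state is [rho] up to [e] ([optimal_cost_ge],
    [optimal_cost_le]).  Near-minimizers are taken in a finite net of actions,
    where a measurable choice is elementary.  Letting [e] tend to [0] shows that
    the optimal cost is a real number independent of the state.

    Approximate solutions come from iterating a Bellman operator that contracts
    the uniform norm ([value_iteration]): the differences of consecutive
    iterates decay geometrically, and any property preserved by the operator
    (continuity, a Lipschitz or Hoelder constant) is inherited.  Under the
    minorization condition the contraction is obtained by replacing [T] with
    [T - nu], of mass [kappa], the integral of [v] against [nu] playing the role
    of [rho].  In the Lipschitz case with [KT < 1] there is no minorization and
    [T] is replaced with [(1 - eta) T], the error being [eta] times the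
    oscillation of [v], which is bounded independently of [eta].

    To compare a finite [L] with [U], an approximate solution for [U] is used
    with actions in [L]: the loss is at most the variation of
    [c (x, u) + \int v dT(x, u)] when [u] moves to a closest point of [L].
    Under weak continuity this is small by uniform continuity.  In the Lipschitz
    case [v] is Lipschitz with constant [K = Kc + KT K].  In the last case [v] is
    [delta]-Hoelder with a constant [H] solving
    [H = Kc M^(1 - delta) + kappa (KT / kappa)^delta H]; the key estimate
    ([minorized_mean_holder]) is that integrals of an [H]-Hoelder function
    against two transition laws at Wasserstein distance [W] differ by at most
    [kappa H (W / kappa)^delta].  It is proved by approximating [v] from below by
    the Lipschitz function [inf_y (v y + K d(x, y))], whose slope [K] is that of
    the tangent to [r |-> H r^delta] at [W / kappa]: the Lipschitz part is
    integrated against a coupling, the remainder against [T - nu]. *)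

(** * Bounded measurable functions *)

Section bounded_measurable.
Context (R : realType) d (V : measurableType d).
Implicit Types (f g : V -> R) (mu : {measure set V -> \bar R}).

Definition bounded_measurable f :=
  measurable_fun [set: V] f /\ exists M : R, forall x, `|f x| <= M.

Lemma bounded_measurable_cst (r : R) : bounded_measurable (fun=> r).
Proof. by split; [exact: measurable_cst | exists `|r|]. Qed.

Lemma bounded_measurableD f g : bounded_measurable f -> bounded_measurable g ->
  bounded_measurable (fun x => f x + g x).
Proof.
move=> [mf [M fM]] [mg [N gN]]; split; first exact: measurable_funD.
by exists (M + N) => x; rewrite (le_trans (ler_normD _ _))// lerD.
Qed.

Lemma bounded_measurableZ r f : bounded_measurable f ->
  bounded_measurable (fun x => r * f x).
Proof.
move=> [mf [M fM]]; split; first exact: measurable_funM.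
by exists (`|r| * M) => x; rewrite normrM ler_wpM2l.
Qed.

Lemma bounded_measurableB f g : bounded_measurable f -> bounded_measurable g ->
  bounded_measurable (fun x => f x - g x).
Proof.
move=> bf bg; rewrite (_ : (fun _ => _) = fun x => f x + -1 * g x).
  by apply: bounded_measurableD => //; exact: bounded_measurableZ.
by apply/funext => x; rewrite mulN1r.
Qed.

Lemma bounded_measurable_sum n (f : 'I_n -> V -> R) :
  (forall i, bounded_measurable (f i)) ->
  bounded_measurable (fun x => \sum_(i < n) f i x).
Proof.
elim: n f => [|n IH] f bf.
  rewrite (_ : (fun _ => _) = fun=> 0); first exact: bounded_measurable_cst.
  by apply/funext => x; rewrite big_ord0.
rewrite (_ : (fun _ => _) = fun x => \sum_(i < n) f (widen_ord (leqnSn n) i) x +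
    f ord_max x); last by apply/funext => x; rewrite big_ord_recr.
by apply: bounded_measurableD => //; apply: IH.
Qed.

Lemma bounded_measurable_integrable mu f : (mu setT < +oo)%E ->
  bounded_measurable f -> mu.-integrable [set: V] (EFin \o f).
Proof.
move=> muT [mf [M fM]]; apply: measurable_bounded_integrable => //.
exists M; split=> [|r Mr x _ /=]; first exact: num_real.
exact: le_trans (fM x) (ltW Mr).
Qed.

Section finite_mass.
Context mu (muT : (mu setT < +oo)%E).

Lemma EFin_Rintegral f : bounded_measurable f ->
  (\int[mu]_x (f x)%:E = (\int[mu]_x f x)%:E)%E.
Proof.
move=> bf; rewrite /Rintegral fineK//.
exact: integrable_fin_num (bounded_measurable_integrable muT bf).
Qed.

Lemma le_Rintegral_bounded f g : bounded_measurable f -> bounded_measurable g ->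
  (forall x, f x <= g x) -> \int[mu]_x f x <= \int[mu]_x g x.
Proof.
move=> bf bg fg.
by apply: le_Rintegral => //; exact: bounded_measurable_integrable.
Qed.

Lemma RintegralD_bounded f g : bounded_measurable f -> bounded_measurable g ->
  \int[mu]_x (f x + g x) = \int[mu]_x f x + \int[mu]_x g x.
Proof.
by move=> bf bg; apply: RintegralD => //; exact: bounded_measurable_integrable.
Qed.

Lemma RintegralB_bounded f g : bounded_measurable f -> bounded_measurable g ->
  \int[mu]_x (f x - g x) = \int[mu]_x f x - \int[mu]_x g x.
Proof.
by move=> bf bg; apply: RintegralB => //; exact: bounded_measurable_integrable.
Qed.

Lemma RintegralZ_bounded r f : bounded_measurable f ->
  \int[mu]_x (r * f x) = r * \int[mu]_x f x.
Proof.
by move=> bf; apply: RintegralZl => //; exact: bounded_measurable_integrable.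
Qed.

End finite_mass.

Section probability_mass.
Context mu (muT : mu setT = 1%E).

Let muT_lty : (mu setT < +oo)%E. Proof. by rewrite muT ltry. Qed.

Lemma Rintegral_cstD r f : bounded_measurable f ->
  \int[mu]_x (r + f x) = r + \int[mu]_x f x.
Proof.
move=> bf; rewrite RintegralD_bounded//; last exact: bounded_measurable_cst.
by rewrite Rintegral_cst// muT mulr1.
Qed.

Lemma Rintegral_Dcst r f : bounded_measurable f ->
  \int[mu]_x (f x + r) = \int[mu]_x f x + r.
Proof.
by move=> bf; under eq_Rintegral do rewrite addrC; rewrite Rintegral_cstD// addrC.
Qed.

End probability_mass.
End bounded_measurable.

(** * Expected total cost under a policy *)

Section history_integral.
Context (R : realType) (dX dU : measure_display)
  (X : polishType dX R) (U : polishType dU R) (T : R.-pker (X * U) ~> X)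
  (pi : policy X U).
Local Open Scope ereal_scope.

(** One more stage of the process: draw an action from the policy, then the next
    state from [T].  The two kernel compositions in the definition of the law are
    unfolded by the disintegration formula for composed kernels. *)
Lemma integral_history_law_next n x (G : history X U n.+1 -> \bar R) :
  (forall h, 0 <= G h) -> measurable_fun [set: history X U n.+1] G ->
  \int[history_law T pi n.+1 x]_h G h =
  \int[history_law T pi n x]_h \int[pi n h]_u \int[T (h.2, u)]_y
    G (next_history (h, u, y)).
Proof.
move=> G0 mG.
transitivity (\int[history_law T pi n x]_h \int[history_step T pi h]_h' G h').
  have := @integral_kcomp _ _ _ X (history X U n) (history X U n.+1) R
    (history_law T pi n) (kernel.kernel_snd (@history_step _ _ _ _ _ T n pi))
    x G G0 mG.
  move=> <-.
  by apply: eq_measure_integral => A mA _.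
apply: eq_integral => h _.
transitivity (\int[pi n h]_u \int[history_trans_kernel T (h, u)]_h' G h').
  have := @integral_kcomp _ _ _ (history X U n) U (history X U n.+1) R
    (pi n) (@history_trans_kernel _ _ _ _ _ T n) h G G0 mG.
  move=> <-.
  by apply: eq_measure_integral => A mA _.
apply: eq_integral => u _.
have mf : measurable_fun [set: X] (fun y => next_history (h, u, y)).
  apply: measurableT_comp (@measurable_next_history _ _ _ X U n) _.
  by apply: measurable_fun_pair.
transitivity (\int[pushforward (T (h.2, u)) (fun y => next_history (h, u, y))]_h' G h').
  by apply: eq_measure_integral => A mA _.
rewrite (ge0_integral_pushforward mf)//.
Qed.
End history_integral.

Section verification.
Context (R : realType) (dX dU : measure_display)
  (X : polishType dX R) (U : polishType dU R) (T : R.-pker (X * U) ~> X).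
Implicit Types (c : X * U -> R) (v : X -> R) (L : set U) (pi : policy X U).

(** The quantity minimized over actions in the optimality equation; with [v] a
    relative value function it is usually called a Q-function. *)
Definition action_value c v (z : X * U) : R := c z + \int[T z]_y v y.

Lemma kernel_mass_lty z : (T z setT < +oo)%E.
Proof. by rewrite prob_kernel ltry. Qed.

(** Shifting [v] by its bound makes the integrand nonnegative, and the integral is
    then measurable in [z] as a monotone limit of kernel integrals of simple
    functions. *)
Lemma bounded_measurable_action_value c v :
  bounded_measurable c -> bounded_measurable v ->
  bounded_measurable (action_value c v).
Proof.
move=> bc bv; apply: bounded_measurableD => //.
have [mv [M vM]] := bv.
split; last first.
  exists M => z; rewrite ler_norml; apply/andP; split.
    rewrite -[leLHS](_ : \int[T z]_y (- M) = _); last first.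
      by rewrite Rintegral_cst// prob_kernel mulr1.
    apply: (le_Rintegral_bounded (kernel_mass_lty z)) => //.
      exact: bounded_measurable_cst.
    by move=> y; have := vM y; rewrite ler_norml => /andP[].
  rewrite -[leRHS](_ : \int[T z]_y M = _); last first.
    by rewrite Rintegral_cst// prob_kernel mulr1.
  apply: (le_Rintegral_bounded (kernel_mass_lty z)) => //.
    exact: bounded_measurable_cst.
  by move=> y; have := vM y; rewrite ler_norml => /andP[].
have bM := bounded_measurableD bv (bounded_measurable_cst _ M).
rewrite (_ : (fun _ => _) = fun z => \int[T z]_y (v y + M) - M); last first.
  by apply/funext => z; rewrite (Rintegral_Dcst (prob_kernel z) _ bv) addrK.
apply: measurable_funB => //; apply/measurable_EFinP.
rewrite (_ : _ \o _ = fun z => (\int[T z]_y (v y + M)%:E)%E); last first.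
  by apply/funext => z /=; rewrite (EFin_Rintegral (kernel_mass_lty z) bM).
apply: measurable_fun_integral_kernel.
- by move=> A mA; exact: measurable_kernel.
- by move=> y; rewrite lee_fin; have := vM y; rewrite ler_norml; lra.
- by apply/measurable_EFinP; exact: bM.1.
Qed.

Definition total_cost c n (h : history X U n) : R := \sum_(t < n) c (tnth h.1 t).

Lemma total_cost_next c n (h : history X U n) u y :
  total_cost c (next_history (h, u, y)) = total_cost c h + c (h.2, u).
Proof.
rewrite /total_cost big_ord_recr /=; congr (_ + _).
  apply: eq_bigr => i _; congr c.
  by rewrite !(tnth_nth (h.2, u)) /= nth_rcons size_tuple ltn_ord.
by congr c; rewrite (tnth_nth (h.2, u)) /= nth_rcons size_tuple ltnn eqxx.
Qed.

Lemma total_costN c n (h : history X U n) :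
  total_cost (fun z => - c z) h = - total_cost c h.
Proof. by rewrite /total_cost sumrN. Qed.

Lemma bounded_measurable_total_cost c n : bounded_measurable c ->
  bounded_measurable (@total_cost c n).
Proof.
move=> [mc [M cM]]; apply: bounded_measurable_sum => i; split; last by exists M.
exact: (measurableT_comp mc (measurableT_comp (measurable_tnth i) measurable_fst)).
Qed.

Lemma history_law_lty pi n x : (history_law T pi n x setT < +oo)%E.
Proof. by rewrite history_law_prob ltry. Qed.

(** If [rho + v <= action_value c v] along the policy, then the total cost plus
    [v] of the current state, minus [n rho], is a submartingale.  Only its
    expectation matters, and [v] is bounded by [N]. *)
Lemma expected_total_cost_ge c v (rho N : R) pi n x :
  bounded_measurable c -> measurable_fun setT v -> (forall y, `|v y| <= N) ->
  (forall t h, {ae pi t h, forall u, rho + v h.2 <= action_value c v (h.2, u)}) ->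
  n%:R * rho - 2 * N <= \int[history_law T pi n x]_h total_cost c h.
Proof.
move=> bc mv vN opt.
have [mc [M0 cM0]] := bc.
(* Shifting the cost by [M] and [v] by [N] makes all integrands and the per-stage
   increment [rho + M] nonnegative. *)
pose M := Num.max M0 `|rho|.
have cM z : `|c z| <= M by rewrite le_max cM0.
have rM : `|rho| <= M by rewrite le_max lexx orbT.
have bv : bounded_measurable v by split => //; exists N.
have bV : bounded_measurable (fun y => v y + N).
  by apply: bounded_measurableD => //; exact: bounded_measurable_cst.
pose g n (h : history X U n) : R := total_cost c h + n%:R * M + (v h.2 + N).
have bg k : bounded_measurable (@g k).
  apply: bounded_measurableD; last first.
    by split; [exact: measurableT_comp bV.1 _ | case: bV => _ [P ?]; exists P].
  apply: bounded_measurableD; first exact: bounded_measurable_total_cost.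
  exact: bounded_measurable_cst.
have mg k : measurable_fun [set: history X U k] (fun h => (g k h)%:E).
  by apply/measurable_EFinP; exact: (bg k).1.
have V0 y : 0 <= v y + N by have := vN y; rewrite ler_norml; lra.
have t0 k (h : history X U k) : 0 <= total_cost c h + k%:R * M.
  have -> : k%:R * M = \sum_(t < k) M by rewrite sumr_const card_ord mulr_natl.
  rewrite /total_cost -big_split/= sumr_ge0// => i _.
  by have := cM (tnth h.1 i); rewrite ler_norml; lra.
have g0 k h : 0 <= @g k h.
  by rewrite /g addr_ge0.
have stepE k (h : history X U k) u y :
    g k.+1 (next_history (h, u, y)) =
    (total_cost c h + k%:R * M + (c (h.2, u) + M)) + (v y + N).
  rewrite /g total_cost_next /= -[k.+1%:R]natr1; ring.
have A0 k (h : history X U k) u :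
    0 <= total_cost c h + k%:R * M + (c (h.2, u) + M).
  by have := cM (h.2, u); have := t0 k h; rewrite ler_norml; lra.
have innerE k (h : history X U k) u :
    (\int[T (h.2, u)]_y (g k.+1 (next_history (h, u, y)))%:E =
     (total_cost c h + k%:R * M + M + N + action_value c v (h.2, u))%:E)%E.
  under eq_integral do rewrite stepE.
  rewrite EFin_Rintegral; [|exact: kernel_mass_lty|]; last first.
    by apply: bounded_measurableD => //; exact: bounded_measurable_cst.
  congr EFin; rewrite Rintegral_cstD ?prob_kernel// Rintegral_Dcst ?prob_kernel//.
  rewrite /action_value; ring.
have key k : ((k%:R * (rho + M) + (v x + N))%:E <=
    \int[history_law T pi k x]_h (g k h)%:E)%E.
  elim: k => [|k IH].
    rewrite /= /kdirac integral_dirac//; last first.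
      exact: (mg 0%N).
    rewrite diracT mul1e lee_fin /g /total_cost big_ord0 /= !mul0r; lra.
  rewrite integral_history_law_next; last 2 first.
    by move=> h; rewrite lee_fin.
    exact: mg.
  apply: (@le_trans _ _ (\int[history_law T pi k x]_h (g k h + (rho + M))%:E)%E).
    have bgr := bounded_measurableD (bg k) (bounded_measurable_cst _ (rho + M)).
    move: IH; rewrite (EFin_Rintegral (history_law_lty pi k x) (bg k)).
    rewrite (EFin_Rintegral (history_law_lty pi k x) bgr).
    rewrite (Rintegral_Dcst (history_law_prob T pi k x) _ (bg k)) !lee_fin.
    rewrite -[k.+1%:R]natr1.
    by move=> ?; lra.
  have rM0 : 0 <= rho + M by move: rM; rewrite ler_norml; lra.
  have mQ : measurable_fun [set: history X U k * U] (fun hu =>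
      \int[T (hu.1.2, hu.2)]_y (g k.+1 (next_history (hu.1, hu.2, y)))%:E)%E.
    under eq_fun do rewrite innerE.
    apply/measurable_EFinP; apply: measurable_funD.
      do 3 (apply: measurable_funD => //).
      exact: measurableT_comp (bounded_measurable_total_cost k bc).1 _.
    apply: measurableT_comp; first exact: (bounded_measurable_action_value bc bv).1.
    by apply: measurable_fun_pair => //; exact: measurableT_comp.
  apply: ge0_le_integral => //.
  - by move=> h _; rewrite lee_fin addr_ge0.
  - apply/measurable_EFinP; apply: measurable_funD => //; exact: (bg k).1.
  - apply: (measurable_fun_integral_sfinite_kernel (fun hu =>
      \int[T (hu.1.2, hu.2)]_y (g k.+1 (next_history (hu.1, hu.2, y)))%:E)%E
      (pi k) _ mQ) => z.
    by apply: integral_ge0 => y _; rewrite lee_fin.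
  - move=> h _.
    have -> : (g k h + (rho + M))%:E =
        (\int[pi k h]_u (cst (g k h + (rho + M))%:E u))%E.
      by rewrite integral_cst// prob_kernel mule1.
    apply: ae_ge0_le_integral => //.
    + by move=> u _; rewrite lee_fin addr_ge0.
    + by move=> u _; apply: integral_ge0 => y _; rewrite lee_fin.
    + exact: (measurableT_comp mQ (pair1_measurable h)).
    + apply: filterS (opt k h) => u hu _.
      by rewrite innerE /= lee_fin /g; move: hu; lra.
have := key n; rewrite (EFin_Rintegral (history_law_lty pi n x) (bg n)) lee_fin => kn.
have bt := bounded_measurable_total_cost n bc.
have btr := bounded_measurableD bt (bounded_measurable_cst _ (n%:R * M + 2 * N)).
have : \int[history_law T pi n x]_h g n h <=
    \int[history_law T pi n x]_h (total_cost c h + (n%:R * M + 2 * N)).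
  apply: (le_Rintegral_bounded (history_law_lty pi n x) (bg n) btr) => h.
  by rewrite /g; have := vN h.2; rewrite ler_norml; lra.
rewrite (Rintegral_Dcst (history_law_prob T pi n x) _ bt).
by have := vN x; rewrite ler_norml; lra.
Qed.

Lemma action_valueN c v z : bounded_measurable v ->
  action_value (fun z => - c z) (fun y => - v y) z = - action_value c v z.
Proof.
move=> bv; rewrite /action_value opprD; congr (_ + _).
under eq_Rintegral do rewrite -mulN1r.
by rewrite (RintegralZ_bounded (kernel_mass_lty z)) ?mulN1r.
Qed.

(** The lower bound applied to [- c], [- v] and [- rho]. *)
Lemma expected_total_cost_le c v (rho N : R) pi n x :
  bounded_measurable c -> measurable_fun setT v -> (forall y, `|v y| <= N) ->
  (forall t h, {ae pi t h, forall u, action_value c v (h.2, u) <= rho + v h.2}) ->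
  \int[history_law T pi n x]_h total_cost c h <= n%:R * rho + 2 * N.
Proof.
move=> bc mv vN opt.
have bv : bounded_measurable v by split => //; exists N.
have := @expected_total_cost_ge (fun z => - c z) (fun y => - v y) (- rho) N pi n x.
have bNc : bounded_measurable (fun z => - c z).
  rewrite (_ : (fun _ => _) = fun z => -1 * c z); first exact: bounded_measurableZ.
  by apply/funext => z; rewrite mulN1r.
have mNv : measurable_fun setT (fun y => - v y) by exact: measurable_funN.
have vNN y : `|- v y| <= N by rewrite normrN.
have optN t h : {ae pi t h, forall u,
    - rho - v h.2 <= action_value (fun z => - c z) (fun y => - v y) (h.2, u)}.
  by apply: filterS (opt t h) => u hu; rewrite action_valueN//; lra.
move=> /(_ bNc mNv vNN optN).
under eq_Rintegral do rewrite total_costN -mulN1r.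
rewrite (RintegralZ_bounded (history_law_lty pi n x)); last first.
  exact: bounded_measurable_total_cost.
lra.
Qed.

Lemma average_costE c pi x : bounded_measurable c ->
  average_cost T pi c x = limn_esup (fun n =>
    (n%:R^-1 * \int[history_law T pi n x]_h total_cost c h)%:E).
Proof.
move=> bc; rewrite /average_cost; congr limn_esup; apply/funext => n.
rewrite EFinM -(EFin_Rintegral (history_law_lty pi n x))//.
exact: bounded_measurable_total_cost.
Qed.

End verification.

(** * Bounds on the long-run average cost *)

Section limsup.
Context (R : realType).
Local Open Scope ereal_scope.

Lemma le_limn_esup (u w : (\bar R)^nat) :
  (\forall n \near \oo, u n <= w n) -> limn_esup u <= limn_esup w.
Proof.
move=> uw; rewrite /limn_esup /limf_esup; apply: le_ereal_inf_tmp => _ /= [V oV <-].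
apply: (@le_trans _ _ (ereal_sup (u @` (V `&` [set n | u n <= w n])))).
  by apply: ereal_inf_lbound; exists (V `&` [set n | u n <= w n]) => //; exact: filterI.
apply: ge_ereal_sup => _ /= [n [Vn uwn] <-].
by apply: (le_trans uwn); apply: ereal_sup_ubound; exists n.
Qed.

Lemma limn_esup_affine_average (rho N : R) :
  limn_esup (fun n => (n%:R^-1 * (n%:R * rho + N))%:E) = rho%:E.
Proof.
apply: (cvg_limn_einf_sup _).2.
apply/fine_cvgP; split; first by near=> n.
rewrite -cvg_shiftS /=.
rewrite (_ : (fun _ => _) = (fun n => rho + n.+1%:R^-1 * N)%R); last first.
  by apply/funext => n /=; rewrite mulrDr mulKf.
rewrite /comp /=.
have {2}-> : rho = (rho + 0 * N)%R by rewrite mul0r addr0.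
by apply: cvgD; [exact: cvg_cst|apply: cvgM; [exact: cvg_harmonic|exact: cvg_cst]].
Unshelve. all: end_near. Qed.

End limsup.

Section average.
Context (R : realType) (dX dU : measure_display)
  (X : polishType dX R) (U : polishType dU R) (T : R.-pker (X * U) ~> X).
Implicit Types (c : X * U -> R) (v : X -> R) (L : set U) (pi : policy X U).

Lemma average_cost_ge c v (rho : R) pi x :
  bounded_measurable c -> bounded_measurable v ->
  (forall t h, {ae pi t h, forall u, rho + v h.2 <= action_value T c v (h.2, u)}) ->
  (rho%:E <= average_cost T pi c x)%E.
Proof.
move=> bc [mv [N vN]] opt; rewrite average_costE//.
rewrite -(limn_esup_affine_average rho (- (2 * N))).
apply: le_limn_esup; near=> n; rewrite lee_fin ler_wpM2l ?invr_ge0//.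
exact: expected_total_cost_ge mv vN opt.
Unshelve. all: end_near. Qed.

Lemma average_cost_le c v (rho : R) pi x :
  bounded_measurable c -> bounded_measurable v ->
  (forall t h, {ae pi t h, forall u, action_value T c v (h.2, u) <= rho + v h.2}) ->
  (average_cost T pi c x <= rho%:E)%E.
Proof.
move=> bc [mv [N vN]] opt; rewrite average_costE//.
rewrite -(limn_esup_affine_average rho (2 * N)).
apply: le_limn_esup; near=> n; rewrite lee_fin ler_wpM2l ?invr_ge0//.
exact: expected_total_cost_le mv vN opt.
Unshelve. all: end_near. Qed.

Lemma measurable_finite_set L : finite_set L -> measurable L.
Proof.
move=> fL; have cL : closed L.
  by apply: compact_closed; [exact: metric_hausdorff | exact: finite_compact].
rewrite -[L]setCK; apply: measurableC; rewrite polish_borel.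
by apply: sub_sigma_algebra; exact: closed_openC.
Qed.

(** Among finitely many actions, take the first admissible one in a fixed
    enumeration: the choice is measurable as a nested conditional. *)
Lemma measurable_selector d (V : measurableType d) (L : set U)
    (h : V -> U -> R) (g : V -> R) :
  finite_set L ->
  (forall u, measurable_fun setT (h ^~ u)) -> measurable_fun setT g ->
  (forall x, exists2 u, L u & h x u <= g x) ->
  exists f : V -> U, [/\ measurable_fun setT f, forall x, L (f x) &
    forall x, h x (f x) <= g x].
Proof.
move=> /finite_seqP[s ->] mh mg hg.
have [f [mf fP]] : exists f : V -> U, measurable_fun setT f /\
    forall x, (exists2 u, u \in s & h x u <= g x) -> f x \in s /\ h x (f x) <= g x.
  elim: s {hg} => [|u s [f [mf fP]]].
    by exists (cst point); split; [exact: measurable_cst | move=> x [u]].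
  exists (fun x => if h x u <= g x then u else f x); split.
    apply: measurable_fun_ifT => //.
    exact: measurable_fun_ler.
  move=> x [u' us ux]; case: ifPn => [hu|hu]; first by rewrite mem_head.
  have [] := fP x.
    exists u' => //; move: us; rewrite inE => /orP[/eqP uu|//].
    by move: hu; rewrite -uu ux.
  by move=> ? ?; rewrite inE orbC; split => //; apply/orP; left.
by exists f; split => // x; have [] := fP x (hg x).
Qed.

(** Actions outside [L] form a null set for every policy admissible for [L]. *)
Lemma optimal_cost_ge c v L (rho : R) x : measurable L ->
  bounded_measurable c -> bounded_measurable v ->
  (forall y u, L u -> rho + v y <= action_value T c v (y, u)) ->
  (rho%:E <= optimal_cost T c L x)%E.
Proof.
move=> mL bc bv opt; apply: le_ereal_inf_tmp => _ /= [pi adm <-].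
apply: (average_cost_ge _ bc bv) => t h.
exists (~` L); split.
- exact: measurableC.
- have piT : pi t h setT = 1%E by exact: prob_kernel.
  have piTy : (pi t h setT < +oo)%E by rewrite piT ltry.
  have piL : pi t h L = 1%E by exact: adm.
  have : pi t h setT = (pi t h L + pi t h (~` L))%E.
    rewrite -(setUv L); exact: (measureU _ mL (measurableC mL) (setICr L)).
  rewrite piT piL.
  case: (pi t h (~` L)) => [r| |]//= /eqP.
  by rewrite -EFinD eqe addrC -subr_eq subrr => /eqP <-.
- by move=> u /= nopt Lu; apply: nopt; exact: opt.
Qed.

(** The stationary deterministic policy given by a selector achieves [rho].  The
    inequality is required on a finite subset [L'] of the action set [L], so that
    an elementary selector exists even when [L] is infinite. *)
Lemma optimal_cost_le c v L L' (rho : R) x :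
  finite_set L' -> L' `<=` L -> bounded_measurable c -> bounded_measurable v ->
  (forall y, exists2 u, L' u & action_value T c v (y, u) <= rho + v y) ->
  (optimal_cost T c L x <= rho%:E)%E.
Proof.
move=> fL' L'L bc bv opt.
have bQ := bounded_measurable_action_value T bc bv.
have [||f [mf L'f fP]] := measurable_selector fL' _ _ opt.
- by move=> u; exact: (measurableT_comp bQ.1 (pair2_measurable u)).
- by apply: measurable_funD => //; exact: bv.1.
have mfs t : measurable_fun [set: history X U t] (fun h => f h.2).
  exact: measurableT_comp.
pose pi : policy X U := fun t => kdirac (mfs t).
apply: le_trans (_ : average_cost T pi c x <= _)%E.
  apply: ereal_inf_lbound; exists pi => // t h.
  by rewrite /pi /= /kdirac diracE mem_set//; exact: L'L.
apply: average_cost_le bc bv _ => t h.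
have mf1 : measurable [set f h.2] by exact: measurable_finite_set.
exists (~` [set f h.2]); split.
- exact: measurableC.
- by rewrite /pi /= /kdirac diracE memNset//; apply.
- by move=> u /= nopt uf; apply: nopt; rewrite uf.
Qed.

Lemma optimal_costS c L L' x : L' `<=` L -> measurable L -> measurable L' ->
  (optimal_cost T c L x <= optimal_cost T c L' x)%E.
Proof.
move=> L'L mL mL'; apply: le_ereal_inf => _ /= [pi adm <-]; exists pi => // t h.
apply/eqP; rewrite eq_le; apply/andP; split.
  have <- : pi t h setT = 1%E by exact: prob_kernel.
  by rewrite le_measure ?inE.
by rewrite -(adm t h) le_measure ?inE.
Qed.

(** The approximations [rho] do not depend on [x], so the optimal costs from any
    two states are finite and arbitrarily close. *)
Lemma is_optimal_cost_approx c L :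
  (forall e : R, 0 < e -> exists rho : R, forall x,
    ((rho - e)%:E <= optimal_cost T c L x /\
     optimal_cost T c L x <= (rho + e)%:E)%E) ->
  exists r, is_optimal_cost T c L r.
Proof.
move=> H; exists (fine (optimal_cost T c L point)) => x.
have fin y : optimal_cost T c L y \is a fin_num.
  have [rho /(_ y) [lo hi]] := H 1 ltr01.
  rewrite fin_numE -ltNye -ltey (lt_le_trans (ltNyr _) lo).
  exact: le_lt_trans hi (ltry _).
suff <- : fine (optimal_cost T c L x) = fine (optimal_cost T c L point).
  by rewrite fineK.
apply/eqP; rewrite -subr_eq0 -normr_le0; apply/ler_addgt0Pl => e e0.
have e20 : 0 < e / 2 by rewrite divr_gt0.
have [rho Hr] := H _ e20.
move: (Hr x) (fin x) (Hr point) (fin point).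
case: (optimal_cost T c L x) => [a| |]//; rewrite !lee_fin => -[? ?] _.
case: (optimal_cost T c L point) => [b| |]//; rewrite !lee_fin => -[? ?] _ /=.
by rewrite ler_norml; lra.
Qed.

End average.

(** * Value iteration for a contracting operator *)

Section value_iteration.
Context (R : realType) (X U : Type) (L : set U).
Hypothesis L0 : L !=set0.

(** Taking the infimum over actions is nonexpansive; all regularity of Bellman
    iterates derives from this. *)
Lemma inf_image_le (f g : U -> R) (a B : R) :
  (forall u, L u -> B <= f u) -> (forall u, L u -> f u <= g u + a) ->
  inf (f @` L) <= inf (g @` L) + a.
Proof.
move=> Bf fg; rewrite -lerBlDr; apply: lb_le_inf.
  by have [u Lu] := L0; exists (g u), u.
move=> _ [u Lu <-]; rewrite lerBlDr (le_trans _ (fg u Lu))//.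
by apply: ge_inf; [exists B => _ [w Lw <-]; exact: Bf | exists u].
Qed.

Variables (c : X * U -> R) (M : R) (cM : forall z, `|c z| <= M).
Variables (E : (X -> R) -> X * U -> R) (F : set (X -> R)) (k : R).

Definition bellman (v : X -> R) (x : X) : R :=
  inf [set c (x, u) + E v (x, u) | u in L].

Hypotheses (k0 : 0 <= k) (k1 : k < 1).
Hypothesis F0 : F (fun=> 0).
Hypothesis F_bellman : forall v, F v -> F (bellman v).
Hypothesis F_bounded : forall v, F v -> exists N : R, forall x, `|v x| <= N.
Hypothesis E0 : forall z, E (fun=> 0) z = 0.
Hypothesis E_contract : forall v w (a : R), F v -> F w ->
  (forall x, `|v x - w x| <= a) -> forall z, `|E v z - E w z| <= k * a.

Let lbound_bellman v : F v -> exists B : R, forall x u, B <= c (x, u) + E v (x, u).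
Proof.
move=> Fv; have [N vN] := F_bounded Fv; exists (- (M + k * N)) => x u.
have : `|E v (x, u) - E (fun=> 0) (x, u)| <= k * N.
  by apply: E_contract => // y; rewrite subr0.
by have := cM (x, u); rewrite E0 subr0 !ler_norml; lra.
Qed.

Let bellman_contract v w (a : R) : F v -> F w -> (forall x, `|v x - w x| <= a) ->
  forall x, `|bellman v x - bellman w x| <= k * a.
Proof.
move=> Fv Fw vw x; have H u := E_contract Fv Fw vw (x, u).
have [B vB] := lbound_bellman Fv; have [C wC] := lbound_bellman Fw.
have wv : bellman w x <= bellman v x + k * a.
  apply: inf_image_le => u _; first exact: wC.
  by have := H u; rewrite ler_norml; lra.
have vw' : bellman v x <= bellman w x + k * a.
  apply: inf_image_le => u _; first exact: vB.
  by have := H u; rewrite ler_norml; lra.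
by rewrite ler_norml; lra.
Qed.

(** The iterates from [0] move by at most [k ^+ n * M] at the [n]th step, so a late
    iterate is almost fixed by the Bellman operator.  Unlike a limit of
    the iterates, it belongs to [F] even when [F] is not closed, as for the class
    of functions that are Lipschitz for some constant. *)
Lemma value_iteration (e : R) : 0 < e -> exists2 v, F v &
  (forall x u, L u -> v x <= c (x, u) + E v (x, u) + e) /\
  (forall x, exists2 u, L u & c (x, u) + E v (x, u) <= v x + e).
Proof.
move=> e0; pose V n := iter n bellman (fun=> 0).
have FV n : F (V n) by elim: n => //= n IH; exact: F_bellman.
have VV n x : `|V n.+1 x - V n x| <= k ^+ n * M.
  elim: n x => [|n IH] x; last first.
    by rewrite exprS -mulrA; exact: (bellman_contract (FV n.+1) (FV n) IH).
  rewrite expr0 mul1r /= subr0 /bellman.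
  rewrite (eq_imagel (f' := fun u => c (x, u))) => [|u _]; last by rewrite E0 addr0.
  have Mc u : - M <= c (x, u) by have := cM (x, u); rewrite ler_norml => /andP[].
  rewrite ler_norml; apply/andP; split.
    apply: lb_le_inf; first by have [u Lu] := L0; exists (c (x, u)), u.
    by move=> _ [u Lu <-].
  have [u Lu] := L0; apply: (@le_trans _ _ (c (x, u))); last first.
    by have := cM (x, u); rewrite ler_norml => /andP[].
  by apply: ge_inf; [exists (- M) => _ [w Lw <-] | exists u].
have [n kn] : exists n, k ^+ n * M < e / 2.
  have : k ^+ n * M @[n --> \oo] --> 0.
    rewrite -[X in _ --> X](mul0r M); apply: cvgM; last exact: cvg_cst.
    by apply: cvg_expr; rewrite ger0_norm.
  move=> /cvgrPdist_lt /(_ (e / 2)); rewrite divr_gt0// => /(_ isT).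
  move=> [n _ /(_ n (leqnn n))]; rewrite sub0r normrN => H; exists n.
  exact: le_lt_trans (ler_norm _) H.
exists (V n) => //; have [B vB] := lbound_bellman (FV n).
have hB x : has_inf [set c (x, u) + E (V n) (x, u) | u in L].
  by split; [have [u Lu] := L0; eexists; exists u | exists B => _ [u Lu <-]].
split=> [x u Lu|x].
  have : V n.+1 x <= c (x, u) + E (V n) (x, u).
    by apply: ge_inf; [case: (hB x) | exists u].
  by have := VV n x; rewrite ler_norml; lra.
have e20 : 0 < e / 2 by rewrite divr_gt0.
have [_ [u Lu <-] hu] := inf_adherent e20 (hB x).
exists u => //; move: hu; rewrite -/(bellman (V n) x) -/(V n.+1 x).
by have := VV n x; rewrite ler_norml; lra.
Qed.

End value_iteration.

(** * Compact metric spaces *)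

Section compact_metric.
Context (R : realType) (dX : measure_display) (X : polishType dX R).
Implicit Types (f : X -> R) (L : set X).

Lemma near_mdist (x : X) (P : set X) :
  (\forall y \near x, P y) <-> exists2 d : R, 0 < d & forall y, mdist x y < d -> P y.
Proof.
split.
  move=> /nbhs_ballP[d d0 dP]; exists d => // y xy.
  by apply: dP; rewrite ballEmdist.
move=> [d d0 dP]; apply/nbhs_ballP; exists d => // y.
by rewrite ballEmdist; exact: dP.
Qed.

Lemma measurable_continuous f : continuous f -> measurable_fun [set: X] f.
Proof.
move=> cf; apply: (measurability _ (RGenOpens.measurableE R)).
move=> _ [_ [a [b ->] <-]]; rewrite setTI polish_borel.
apply: sub_sigma_algebra; apply: open_comp; last exact: interval_open.
by move=> x _; exact: cf.
Qed.

Lemma continuousP_mdist f : continuous f <->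
  forall x e, 0 < e -> exists2 d : R, 0 < d &
    forall y, mdist x y < d -> `|f x - f y| < e.
Proof.
split=> [cf x e e0|H x].
  by apply/near_mdist; move/cvgrPdist_lt : (cf x); apply.
by apply/cvgrPdist_lt => e e0; apply/near_mdist; exact: H.
Qed.

Lemma compact_bounded_continuous f : compact [set: X] -> continuous f ->
  exists M : R, forall x, `|f x| <= M.
Proof.
move=> cX cf.
have /compact_bounded[M [_ HM]] : compact (f @` [set: X]).
  by apply: continuous_compact => //; exact: continuous_subspaceT.
by exists (M + 1) => x; apply: HM; [rewrite ltrDl | exists x].
Qed.

Lemma mdist_triangle_sub (x y z : X) : `|mdist x y - mdist x z| <= mdist y z.
Proof.
rewrite ler_norml; have := metric_triangle x z y; have := metric_triangle x y z.
by rewrite (metric_sym z y); lra.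
Qed.

Lemma continuous_mdist (x : X) : continuous (mdist x).
Proof.
apply/continuousP_mdist => y e e0; exists e => // z yz.
exact: le_lt_trans (mdist_triangle_sub x y z) yz.
Qed.

Lemma compact_mdist_bounded : compact [set: X] ->
  exists D : R, forall x y : X, mdist x y <= D.
Proof.
move=> cX; have [M HM] := compact_bounded_continuous cX (@continuous_mdist point).
exists (M + M) => x y; apply: le_trans (metric_triangle _ point _) _.
rewrite (metric_sym x); apply: lerD; exact: le_trans (ler_norm _) (HM _).
Qed.

Lemma mdist_le_diameter (x y : X) : compact [set: X] -> mdist x y <= diameter X.
Proof.
move=> cX; have [D HD] := compact_mdist_bounded cX.
apply: sup_ubound; last by exists x, y.
by exists D => _ [a [b ->]].
Qed.

Lemma compact_net (d : R) : compact [set: X] -> 0 < d ->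
  exists L, [/\ finite_set L, L !=set0 & forall x, exists2 y, L y & mdist x y < d].
Proof.
move=> cX d0; move: (cX); rewrite compact_cover.
move=> /(_ X setT (fun x => (ball x d)^°)) [| x _ |D _ Dcover].
- by move=> x _; exact: open_interior.
- by exists x => //; exact: nbhsx_ballx.
exists (point |` [set` D]); split.
- by rewrite finite_setU; split; [exact: finite_set1 | exact: finite_fset].
- by exists point; left.
- move=> x; have [y Dy /interior_subset] := Dcover x Logic.I.
  by rewrite ballEmdist /= metric_sym => yx; exists y => //; right.
Qed.

(** The infimum over the finite set [L] is attained, and the supremum bounds it
    because a compact space has finite diameter. *)
Lemma covering_radius_attained L : compact [set: X] -> finite_set L -> L !=set0 ->
  forall x, exists2 y, L y & mdist x y <= covering_radius L.
Proof.
move=> cX fL L0 x; have [D HD] := compact_mdist_bounded cX.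
have hlb a : has_lbound [set mdist a v | v in L].
  by exists 0 => _ [v _ <-]; exact: mdist_ge0.
have [y Ly ymin] : exists2 y, L y & forall z, L z -> mdist x y <= mdist x z.
  have /finite_seqP[s Ls] := fL.
  have [z0 Lz0] := L0; rewrite Ls /= in Lz0.
  have : exists2 y, y \in s & forall z, z \in s -> mdist x y <= mdist x z.
    elim: s z0 Lz0 {Ls} => // a s IH z0 _.
    case: s IH => [_|b s IH].
      by exists a; rewrite ?mem_head// => z; rewrite inE => /eqP ->.
    have [y ys ymin] := IH b (mem_head _ _).
    have [ay|ya] := leP (mdist x a) (mdist x y).
      exists a; first exact: mem_head.
      move=> z; rewrite inE => /predU1P[->//|zs].
      exact: le_trans ay (ymin _ zs).
    exists y; first by rewrite inE ys orbT.
    by move=> z; rewrite inE => /predU1P[->|/ymin//]; exact: ltW.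
  by move=> [y ys ymin]; exists y; rewrite Ls.
exists y => //; apply: (@le_trans _ _ (inf [set mdist x v | v in L])).
  by apply: lb_le_inf; [exists (mdist x y), y | move=> _ [z Lz <-]; exact: ymin].
apply: sup_ubound; last by exists x.
exists D => _ [a _ <-]; apply: le_trans (HD a y).
by apply: ge_inf => //; exists y.
Qed.

Lemma covering_radius_ge0 L : compact [set: X] -> finite_set L -> L !=set0 ->
  0 <= covering_radius L.
Proof.
move=> cX fL L0; have [y _] := covering_radius_attained cX fL L0 point.
exact: le_trans (mdist_ge0 _ _).
Qed.

End compact_metric.

Section heine_cantor.
Context (R : realType) (dX dU : measure_display)
  (X : polishType dX R) (U : polishType dU R).
Implicit Types g : X * U -> R.

(** Joint continuity on [X * U] with one radius for both coordinates, the form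
    in which Heine--Cantor and the choice of finite nets are used. *)
Definition continuous_mdist2 g := forall x u e, 0 < e ->
  exists2 d : R, 0 < d & forall x' u', mdist x x' < d -> mdist u u' < d ->
    `|g (x, u) - g (x', u')| < e.

Definition uniformly_continuous_mdist2 g := forall e, 0 < e ->
  exists2 d : R, 0 < d & forall x u x' u', mdist x x' < d -> mdist u u' < d ->
    `|g (x, u) - g (x', u')| < e.

Lemma continuous_continuous_mdist2 g : continuous g -> continuous_mdist2 g.
Proof.
move=> cg x u e e0; have /cvgrPdist_lt /(_ e e0) := cg (x, u).
move=> /nbhs_ballP[d d0 dP]; exists d => // x' u' xx uu.
by apply: (dP (x', u')); split; rewrite /= ballEmdist.
Qed.

(** Needed because weak continuity of the kernel is a statement on sequences. *)
Lemma sequentially_continuous_mdist2 g :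
  (forall (x_ : nat -> X) (u_ : nat -> U) x u,
    x_ @ \oo --> x -> u_ @ \oo --> u ->
    g (x_ n, u_ n) @[n --> \oo] --> g (x, u)) -> continuous_mdist2 g.
Proof.
move=> sg x u e e0; apply: contrapT => H.
have /choice[z Hz] : forall n, exists z : X * U, [/\ mdist x z.1 < n.+1%:R^-1,
    mdist u z.2 < n.+1%:R^-1 & e <= `|g (x, u) - g z|].
  move=> n; apply: contrapT => Hn; apply: H; exists n.+1%:R^-1 => // x' u' xx uu.
  by rewrite ltNge; apply/negP => ge; apply: Hn; exists (x', u').
have cvgd (V : polishType _ R) (w : nat -> V) (a : V) :
    (forall n, mdist a (w n) < n.+1%:R^-1) -> w @ \oo --> a.
  move=> wa; apply/cvg_ballP => d d0; near=> n; rewrite ballEmdist /=.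
  apply: lt_trans (wa n) _; near: n; exact: near_infty_natSinv_lt (PosNum d0).
have := sg (fst \o z) (snd \o z) x u.
move=> /(_ (cvgd _ _ _ _ (fun n => let: And3 a _ _ := Hz n in a))).
move=> /(_ (cvgd _ _ _ _ (fun n => let: And3 _ a _ := Hz n in a))).
move=> /cvgrPdist_lt /(_ e e0)[N _ /(_ N (leqnn N))] /=.
rewrite -surjective_pairing => lt.
by have [_ _] := Hz N; rewrite leNgt lt.
Unshelve. all: end_near. Qed.

(** Around each point, a fixed small radius works for all neighbours; compactness
    of the product makes one radius work for all points at once. *)
Lemma heine_cantor_mdist2 g : compact [set: X] -> compact [set: U] ->
  continuous_mdist2 g -> uniformly_continuous_mdist2 g.
Proof.
move=> cX cU cg e e0.
have cXU : compact [set: X * U] by rewrite -setXTT; exact: compact_setX.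
pose P (d : R) (z : X * U) := forall x' u', mdist z.1 x' < d -> mdist z.2 u' < d ->
  `|g z - g (x', u')| < e.
have Ploc z : [set: X * U] z -> \forall z' \near z & d \near 0^'+, P d z'.
  move=> _; have e20 : 0 < e / 2 by rewrite divr_gt0.
  have [d d0 dP] := cg z.1 z.2 _ e20.
  have d20 : 0 < d / 2 by rewrite divr_gt0.
  exists (ball z (d / 2), [set r : R | r < d / 2]) => /=.
    by split; [exact: nbhsx_ballx | exact: nbhs_right_lt].
  move=> [[x u] r] /= [[]]; rewrite /= !ballEmdist /= => zx zu rd x' u' /= xx uu.
  have := dP x u; have := dP x' u'; rewrite -surjective_pairing => H1 H2.
  have {}H1 : `|g z - g (x', u')| < e / 2.
    apply: H1; apply: le_lt_trans (metric_triangle _ _ _) _.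
      by have := lt_trans xx rd; lra.
    by have := lt_trans uu rd; lra.
  have {}H2 : `|g z - g (x, u)| < e / 2 by apply: H2; lra.
  by move: H1 H2; rewrite !ltr_norml; lra.
have Pall : \forall d \near 0^'+, 0 < d /\ [set: X * U] `<=` P d.
  apply: filterI; first exact: nbhs_right_gt.
  exact: ((compact_near_coveringP _).1 cXU R 0^'+ P _ Ploc).
have [d [d0 dP]] := filter_ex Pall.
by exists d => // x u x' u'; exact: (dP (x, u) Logic.I).
Qed.

End heine_cantor.

(** * Approximate optimality equation *)

Section approximate_optimality.
Context (R : realType) (dX dU : measure_display)
  (X : polishType dX R) (U : polishType dU R) (T : R.-pker (X * U) ~> X)
  (c : X * U -> R) (bc : bounded_measurable c).
Implicit Types (v : X -> R) (L : set U).

(** The average cost optimality equation over the actions [L], up to [e].  The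
    infimum over [L] is split into a lower bound and an almost minimizing action. *)
Definition approx_optimality L (e rho : R) v :=
  [/\ bounded_measurable v,
      forall x u, L u -> rho + v x <= action_value T c v (x, u) + e &
      forall x, exists2 u, L u & action_value T c v (x, u) <= rho + v x + e].

Lemma approx_optimality_cost_ge L e rho v x : measurable L ->
  approx_optimality L e rho v -> ((rho - e)%:E <= optimal_cost T c L x)%E.
Proof.
move=> mL [bv lo _]; apply: (optimal_cost_ge x mL bc bv) => y u Lu.
by have := lo y u Lu; lra.
Qed.

(** The policy may use an action set [L'] other than the set [L] for which [v]
    solves the equation, at the price [b] of moving actions of [L] into [N]. *)
Lemma approx_optimality_cost_le L L' N e b rho v x :
  finite_set N -> N `<=` L' -> approx_optimality L e rho v ->
  (forall y u, L u -> exists2 u', N u' &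
    action_value T c v (y, u') <= action_value T c v (y, u) + b) ->
  (optimal_cost T c L' x <= (rho + e + b)%:E)%E.
Proof.
move=> fN NL' [bv _ hi] net; apply: (optimal_cost_le x fN NL' bc bv) => y.
have [u Lu hu] := hi y; have [u' Nu' hu'] := net y u Lu.
by exists u' => //; lra.
Qed.

(** Total boundedness of the action set, with nets inside the set: this treats
    finite action sets and the compact space [U] uniformly. *)
Definition has_finite_nets L := forall d : R, 0 < d -> exists N,
  [/\ finite_set N, N `<=` L & forall u, L u -> exists2 u', N u' & mdist u u' < d].

Lemma finite_has_finite_nets L : finite_set L -> has_finite_nets L.
Proof. by move=> fL d d0; exists L; split => // u Lu; exists u; rewrite ?mdistxx. Qed.

Lemma compact_has_finite_nets : compact [set: U] -> has_finite_nets [set: U].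
Proof.
move=> cU d d0; have [N [fN _ NP]] := compact_net cU d0.
by exists N; split => // u _.
Qed.

Lemma approx_optimality_is_optimal_cost L : measurable L -> has_finite_nets L ->
  (forall e : R, 0 < e -> exists rho v, approx_optimality L e rho v /\
    uniformly_continuous_mdist2 (action_value T c v)) ->
  exists r, is_optimal_cost T c L r.
Proof.
move=> mL netL H; apply: is_optimal_cost_approx => e e0.
have e20 : 0 < e / 2 by rewrite divr_gt0.
have [rho [v [opt uc]]] := H _ e20.
have [d d0 dP] := uc _ e20; have [N [fN NL NP]] := netL _ d0.
exists rho => x; split.
  apply: le_trans (approx_optimality_cost_ge x mL opt); rewrite lee_fin; lra.
apply: le_trans (approx_optimality_cost_le (b := e / 2) x fN NL opt _) _.
  move=> y u Lu; have [u' Nu' uu'] := NP u Lu; exists u' => //.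
  have := dP y u y u'; rewrite mdistxx => /(_ d0 uu').
  by rewrite ltr_norml; lra.
by rewrite lee_fin; lra.
Qed.

Lemma approx_optimality_gap L (b r rL : R) : finite_set L ->
  is_optimal_cost T c [set: U] r -> is_optimal_cost T c L rL ->
  (forall e : R, 0 < e -> exists rho v, approx_optimality [set: U] e rho v /\
    forall y u, exists2 u', L u' &
      action_value T c v (y, u') <= action_value T c v (y, u) + b) ->
  rL - r <= b.
Proof.
move=> fL optU optL H; apply/ler_addgt0Pl => e e0.
have e20 : 0 < e / 2 by rewrite divr_gt0.
have [rho [v [opt near]]] := H _ e20.
have := approx_optimality_cost_ge point measurableT opt; rewrite optU lee_fin.
have := approx_optimality_cost_le point fL (@subset_refl _ L) opt
  (fun y u _ => near y u).
by rewrite optL lee_fin; lra.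
Qed.

Lemma is_optimal_cost_le L r rL : measurable L ->
  is_optimal_cost T c [set: U] r -> is_optimal_cost T c L rL -> r <= rL.
Proof.
move=> mL optU optL; rewrite -lee_fin -(optU point) -(optL point).
exact: optimal_costS.
Qed.

End approximate_optimality.

Section bellman_modulus.
Context (R : realType) (X U : Type) (L : set U) (c : X * U -> R)
  (E : (X -> R) -> X * U -> R) (v : X -> R).

(** A modulus of continuity in the state, uniform over actions, passes to the
    infimum. *)
Lemma bellman_modulus (B a : R) x y : L !=set0 ->
  (forall z, `|c z + E v z| <= B) ->
  (forall u, `|(c (x, u) + E v (x, u)) - (c (y, u) + E v (y, u))| <= a) ->
  `|bellman L c E v x - bellman L c E v y| <= a.
Proof.
move=> L0 cB xya.
have lb z u : - B <= c (z, u) + E v (z, u).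
  by have := cB (z, u); rewrite ler_norml => /andP[].
have xy : bellman L c E v x <= bellman L c E v y + a.
  apply: (inf_image_le L0) => u _; first exact: lb.
  by have := xya u; rewrite ler_norml; lra.
have yx : bellman L c E v y <= bellman L c E v x + a.
  apply: (inf_image_le L0) => u _; first exact: lb.
  by have := xya u; rewrite ler_norml; lra.
by rewrite ler_norml; lra.
Qed.

End bellman_modulus.

Section minorized.
Context (R : realType) (dX dU : measure_display)
  (X : polishType dX R) (U : polishType dU R) (T : R.-pker (X * U) ~> X)
  (nu : {measure set X -> \bar R}) (minor : minorization T nu).
Implicit Types (v f : X -> R) (L : set U).

(** The constant [kappa] of the theorem: the mass left in every [T z] once [nu] is
    removed. *)
Definition residual_mass : R := 1 - fine (nu setT).

Lemma minorizing_mass_le1 : (nu setT <= 1)%E.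
Proof.
by rewrite -(prob_kernel (s := T) point); case: point => x u; exact: minor.2.
Qed.

Lemma minorizing_mass_lty : (nu setT < +oo)%E.
Proof. exact: le_lt_trans minorizing_mass_le1 (ltry _). Qed.

Lemma residual_mass_lt1 : residual_mass < 1.
Proof.
rewrite /residual_mass ltrBlDr ltrDl fine_gt0// minor.1; exact: minorizing_mass_lty.
Qed.

Lemma residual_mass_ge0 : 0 <= residual_mass.
Proof.
rewrite /residual_mass subr_ge0 -lee_fin fineK; first exact: minorizing_mass_le1.
by rewrite ge0_fin_numE//; exact: minorizing_mass_lty.
Qed.

(** Integration against [T z - nu], a positive functional of total mass
    [residual_mass]; positivity is what makes it contract. *)
Definition minorized_mean v (z : X * U) : R := \int[T z]_y v y - \int[nu]_y v y.

Lemma minorized_mean_cst r z : minorized_mean (fun=> r) z = residual_mass * r.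
Proof.
by rewrite /minorized_mean !Rintegral_cst// prob_kernel /residual_mass /=; ring.
Qed.

Lemma minorized_meanB v w z : bounded_measurable v -> bounded_measurable w ->
  minorized_mean (fun y => v y - w y) z = minorized_mean v z - minorized_mean w z.
Proof.
move=> bv bw; rewrite /minorized_mean (RintegralB_bounded (kernel_mass_lty T z))//.
by rewrite (RintegralB_bounded minorizing_mass_lty)//; ring.
Qed.

Lemma minorized_mean_ge0 f z : bounded_measurable f -> (forall y, 0 <= f y) ->
  0 <= minorized_mean f z.
Proof.
move=> bf f0; rewrite /minorized_mean subr_ge0 -lee_fin.
rewrite -(EFin_Rintegral (kernel_mass_lty T z) bf).
rewrite -(EFin_Rintegral minorizing_mass_lty bf).
apply: ge0_le_measure_integral => //.
- by case: z => x u A mA; exact: minor.2.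
- by apply/measurable_EFinP; exact: bf.1.
Qed.

Lemma minorized_mean_le f C z : bounded_measurable f -> (forall y, f y <= C) ->
  minorized_mean f z <= residual_mass * C.
Proof.
move=> bf fC; rewrite -subr_ge0 -(minorized_mean_cst C z).
have bC := bounded_measurable_cst X C.
rewrite -minorized_meanB//; apply: minorized_mean_ge0 => [|y].
  exact: bounded_measurableB.
by rewrite subr_ge0.
Qed.

Lemma minorized_mean_contract v w (a : R) z :
  bounded_measurable v -> bounded_measurable w ->
  (forall y, `|v y - w y| <= a) ->
  `|minorized_mean v z - minorized_mean w z| <= residual_mass * a.
Proof.
move=> bv bw vw.
have vw1 : minorized_mean v z - minorized_mean w z <= residual_mass * a.
  rewrite -minorized_meanB//; apply: minorized_mean_le => [|y].
    exact: bounded_measurableB.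
  exact: le_trans (ler_norm _) (vw y).
have vw2 : minorized_mean w z - minorized_mean v z <= residual_mass * a.
  rewrite -minorized_meanB//; apply: minorized_mean_le => [|y].
    exact: bounded_measurableB.
  by apply: le_trans (ler_norm _) _; rewrite distrC.
by rewrite ler_norml; lra.
Qed.

Variables (c : X * U -> R) (bc : bounded_measurable c).

Lemma action_value_minorized v z :
  action_value T c v z = c z + minorized_mean v z + \int[nu]_y v y.
Proof. rewrite /action_value /minorized_mean; ring. Qed.

(** Since [T] and [T - nu] differ by the constant [\int v dnu] on [v], an
    approximate fixed point for [T - nu] solves the optimality equation for [T]
    with [rho = \int v dnu]. *)
Lemma minorized_approx_optimality L (F : set (X -> R)) (e : R) : L !=set0 ->
  F (fun=> 0) -> (forall v, F v -> bounded_measurable v) ->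
  (forall v, F v -> F (bellman L c minorized_mean v)) ->
  0 < e -> exists rho v, approx_optimality T c L e rho v /\ F v.
Proof.
move=> L0 F0 Fb FS e0; have [M cM] := bc.2.
have [|||v Fv [lo hi]] := value_iteration L0 cM residual_mass_ge0
  residual_mass_lt1 F0 FS _ _ _ e0.
- by move=> v /Fb[].
- by move=> z; rewrite minorized_mean_cst mulr0.
- by move=> v w a /Fb bv /Fb bw vw z; exact: minorized_mean_contract.
exists (\int[nu]_y v y), v; split => //; split; first exact: Fb.
- by move=> x u /(lo x); rewrite action_value_minorized; lra.
- by move=> x; have [u Lu hu] := hi x; exists u => //; rewrite action_value_minorized; lra.
Qed.

End minorized.

(** * Weakly continuous models *)

Section weakly_continuous.
Context (R : realType) (dX dU : measure_display)
  (X : polishType dX R) (U : polishType dU R) (T : R.-pker (X * U) ~> X)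
  (c : X * U -> R) (mc : measurable_fun [set: X * U] c).

Lemma compact_bounded_measurable (v : X -> R) :
  compact [set: X] -> continuous v -> bounded_measurable v.
Proof.
move=> cX cv; split; first exact: measurable_continuous.
exact: compact_bounded_continuous.
Qed.

Lemma continuous_bellman L (E : (X -> R) -> X * U -> R) v (B : R) : L !=set0 ->
  (forall z, `|c z + E v z| <= B) ->
  uniformly_continuous_mdist2 (fun z => c z + E v z) ->
  continuous (bellman L c E v).
Proof.
move=> L0 cB uc; apply/continuousP_mdist => x e e0.
have e20 : 0 < e / 2 by rewrite divr_gt0.
have [d d0 dP] := uc _ e20; exists d => // y xy.
apply: (@le_lt_trans _ _ (e / 2)); last by lra.
by apply: (bellman_modulus L0 cB) => u; apply/ltW/dP => //; rewrite mdistxx.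
Qed.

Lemma weak_continuity_mean v : weak_continuity T c -> continuous v ->
  uniformly_continuous_mdist2 (fun z => \int[T z]_y v y).
Proof.
move=> [_ _ wc cU cX] cv; apply: heine_cantor_mdist2 => //.
apply: sequentially_continuous_mdist2 => x_ u_ x u xx uu.
have bv := compact_bounded_measurable cX cv.
have := wc x_ u_ x u xx uu v cv bv.2.
rewrite (EFin_Rintegral (kernel_mass_lty T (x, u)) bv).
exact: fine_cvg.
Qed.

Lemma uniformly_continuous_mdist2D (f g : X * U -> R) :
  uniformly_continuous_mdist2 f -> uniformly_continuous_mdist2 g ->
  uniformly_continuous_mdist2 (fun z => f z + g z).
Proof.
move=> uf ug e e0; have e20 : 0 < e / 2 by rewrite divr_gt0.
have [a a0 aP] := uf _ e20; have [b b0 bP] := ug _ e20.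
exists (Num.min a b) => [|x u x' u']; first by rewrite lt_min a0.
rewrite !lt_min => /andP[xa xb] /andP[ua ub].
by have := aP _ _ _ _ xa ua; have := bP _ _ _ _ xb ub; rewrite !ltr_norml; lra.
Qed.

Lemma uniformly_continuous_mdist2_cst (r : R) :
  uniformly_continuous_mdist2 (fun _ : X * U => r).
Proof. by move=> e e0; exists 1 => // *; rewrite subrr normr0. Qed.

Lemma weak_continuity_action_value v : weak_continuity T c -> continuous v ->
  uniformly_continuous_mdist2 (action_value T c v).
Proof.
move=> wc cv; apply: uniformly_continuous_mdist2D; last exact: weak_continuity_mean.
case: wc => _ /continuous_continuous_mdist2 cc _ cU cX.
exact: heine_cantor_mdist2.
Qed.

Lemma weakly_continuous_approx_optimality nu L (e : R) :
  minorization T nu -> weak_continuity T c -> L !=set0 -> 0 < e ->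
  exists rho v, approx_optimality T c L e rho v /\
    uniformly_continuous_mdist2 (action_value T c v).
Proof.
move=> minor wc L0 e0; have [[M cM] _ _ cU cX] := wc.
have bc : bounded_measurable c by split => //; exists M.
have [||||rho [v [opt cv]]] := @minorized_approx_optimality _ _ _ _ _ _ _ minor
    _ bc L [set v | continuous v] e L0.
- by move=> x; exact: cvg_cst.
- by move=> v; exact: compact_bounded_measurable.
- move=> v cv; have bv := compact_bounded_measurable cX cv.
  have cE : (fun z => c z + minorized_mean T nu v z) =
      fun z => action_value T c v z + - \int[nu]_y v y.
    by apply/funext => z; rewrite (action_value_minorized T nu); ring.
  have [N QN] : exists N : R, forall z, `|c z + minorized_mean T nu v z| <= N.
    have [_ [N QN]] := bounded_measurableD (bounded_measurable_action_value T bc bv)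
      (bounded_measurable_cst _ (- \int[nu]_y v y)).
    by exists N => z; move: (QN z); rewrite -(congr1 (fun f => f z) cE).
  apply: (continuous_bellman L0 QN); rewrite cE.
  apply: uniformly_continuous_mdist2D; first exact: weak_continuity_action_value.
  exact: uniformly_continuous_mdist2_cst.
- exact: e0.
by exists rho, v; split => //; exact: weak_continuity_action_value.
Qed.

(** One approximate solution for [U] serves for all fine enough [L], because its
    action values are uniformly continuous in the action. *)
Lemma minorized_finite_actions_converge nu :
  minorization T nu -> weak_continuity T c ->
  exists (rhoU : R) (rho : set U -> R),
   [/\ is_optimal_cost T c [set: U] rhoU,
       (forall L : set U, finite_set L -> L !=set0 ->
          is_optimal_cost T c L (rho L)) &
       forall e : R, 0 < e -> exists2 d : R, 0 < d &
         forall L : set U, finite_set L -> L !=set0 ->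
           covering_radius L < d -> `|rho L - rhoU| < e].
Proof.
move=> minor wc; have [[M cM] _ _ cU cX] := wc.
have bc : bounded_measurable c by split => //; exists M.
have UT0 : [set: U] !=set0 by exists point.
have [rhoU optU] : exists r, is_optimal_cost T c [set: U] r.
  apply: (approx_optimality_is_optimal_cost bc measurableT) => [|e e0].
    exact: compact_has_finite_nets.
  exact: weakly_continuous_approx_optimality minor wc UT0 e0.
have /choice[rho optL] : forall L : set U, exists r : R,
    finite_set L -> L !=set0 -> is_optimal_cost T c L r.
  move=> L; have [[fL L0]|nL] := pselect (finite_set L /\ L !=set0); last first.
    by exists 0 => fL L0; case: nL.
  have [r optr] : exists r, is_optimal_cost T c L r; last by exists r.
  apply: (approx_optimality_is_optimal_cost bc) => [||e e0].
  - exact: measurable_finite_set.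
  - exact: finite_has_finite_nets.
  - exact: weakly_continuous_approx_optimality minor wc L0 e0.
exists rhoU, rho; split => // e e0.
have e40 : 0 < e / 4 by rewrite divr_gt0.
have [r [v [opt uc]]] := weakly_continuous_approx_optimality minor wc UT0 e40.
have [d d0 dP] := uc _ e40; exists d => // L fL L0 Ld.
have mL := measurable_finite_set fL.
have ge0 := is_optimal_cost_le mL optU (optL L fL L0).
have := approx_optimality_cost_ge bc point measurableT opt; rewrite optU lee_fin => lo.
have := @approx_optimality_cost_le _ _ _ _ _ _ _ bc _ _ L (e / 4) (e / 4) _ _ point
  fL (@subset_refl _ L) opt.
rewrite optL// lee_fin => hi; rewrite ger0_norm ?subr_ge0//.
have {}hi : rho L <= r + e / 4 + e / 4.
  apply: hi => y u _; have [u' Lu' uu'] := covering_radius_attained cU fL L0 u.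
  exists u' => //; have := dP y u y u'; rewrite mdistxx => /(_ d0 (le_lt_trans uu' Ld)).
  by rewrite ltr_norml; lra.
lra.
Qed.

End weakly_continuous.

(** * Kantorovich inequality *)

Section kantorovich.
Context (R : realType) (dX : measure_display) (X : polishType dX R).
Implicit Types (mu : {measure set X -> \bar R}) (v : X -> R).

(** The bound [f <= K d] is integrated through the positive part of [f / K].  The
    last step compares suprema over simple functions, for which measurability of
    the smaller integrand is enough. *)
Lemma le_integral_mdist (g : probability (X * X)%type R) (f : X * X -> R) (K : R) :
  0 < K -> bounded_measurable f -> (forall z, f z <= K * mdist z.1 z.2) ->
  ((K^-1 * \int[g]_z f z)%:E <= \int[g]_z (mdist z.1 z.2)%:E)%E.
Proof.
move=> K0 bf fK; have gT : (g setT < +oo)%E by rewrite probability_setT ltry.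
have bKf := bounded_measurableZ K^-1 bf.
rewrite -(RintegralZ_bounded gT _ bf) -(EFin_Rintegral gT bKf).
pose p z := Num.max 0 (K^-1 * f z).
have mp : measurable_fun setT p.
  exact: measurable_maxr (measurable_cst _) bKf.1.
apply: (@le_trans _ _ (\int[g]_z (p z)%:E)%E).
  apply: le_integral => //.
  - exact: bounded_measurable_integrable.
  - apply: bounded_measurable_integrable => //; split => //.
    have [N HN] := bKf.2; exists N => z; rewrite /p.
    have N0 : 0 <= N by exact: le_trans (HN z).
    by case: (leP 0 (K^-1 * f z)) => _ //; rewrite normr0.
  - by move=> z _; rewrite lee_fin /p le_max lexx orbT.
have p0 z : (0 <= (p z)%:E)%E by rewrite lee_fin /p le_max lexx.
have m0 (z : X * X) : (0 <= (mdist z.1 z.2)%:E)%E by rewrite lee_fin mdist_ge0.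
rewrite !ge0_integralTE//; apply: le_ereal_sup => _ [h hp <-]; exists h => // z.
apply: le_trans (hp z) _; rewrite lee_fin /p ge_max mdist_ge0 /=.
by rewrite ler_pdivrMl.
Qed.

Lemma coupling_integral mu mu' (g : probability (X * X)%type R) v :
  coupling mu mu' g -> bounded_measurable v ->
  \int[mu]_y v y = \int[g]_z v z.1 /\ \int[mu']_y v y = \int[g]_z v z.2.
Proof.
move=> cg bv.
have push (phi : X * X -> X) (m : {measure set X -> \bar R}) :
    measurable_fun setT phi -> (forall A, measurable A -> m A = g (phi @^-1` A)) ->
    \int[m]_y v y = \int[g]_z v (phi z).
  move=> mphi mE; rewrite /Rintegral; congr fine.
  transitivity (\int[pushforward g phi]_y (v y)%:E)%E.
    by apply: eq_measure_integral => A mA _; exact: mE.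
  have gT : (g setT < +oo)%E by rewrite probability_setT ltry.
  have bvp : bounded_measurable (fun z => v (phi z)).
    split; first exact: measurableT_comp bv.1 mphi.
    by have [N HN] := bv.2; exists N => z; exact: HN.
  have ig := bounded_measurable_integrable gT bvp.
  rewrite (integral_pushforward mphi) //; last exact/measurable_EFinP/bv.1.
split; apply: push => // A mA.
  by rewrite -(cg A mA).1; congr (g _); apply/seteqP; split => z //= [].
by rewrite -(cg A mA).2; congr (g _); apply/seteqP; split => z //= [].
Qed.

(** The easy half of Kantorovich duality: integrate [v x - v y <= K d(x, y)]
    against every coupling. *)
Lemma Rintegral_sub_le_wasserstein1 mu mu' v (K r : R) : 0 <= K ->
  bounded_measurable v -> (forall x y, v x - v y <= K * mdist x y) ->
  (wasserstein1 mu mu' <= r%:E)%E ->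
  \int[mu]_y v y - \int[mu']_y v y <= K * r.
Proof.
move=> K0 bv vK W.
(* Dividing by the slope requires it to be positive, so [K] is first replaced
   with an arbitrary positive [k >= K]. *)
have pos (k : R) : K <= k -> 0 < k -> \int[mu]_y v y - \int[mu']_y v y <= k * r.
  move=> Kk k0; rewrite -ler_pdivrMl// -lee_fin; apply: le_trans W.
  apply: le_ereal_inf_tmp => _ [g cg <-].
  have [-> ->] := coupling_integral cg bv.
  have gT : (g setT < +oo)%E by rewrite probability_setT ltry.
  have b1 : bounded_measurable (fun z : X * X => v z.1).
    split; first exact: measurableT_comp bv.1 measurable_fst.
    by have [N HN] := bv.2; exists N => z; exact: HN.
  have b2 : bounded_measurable (fun z : X * X => v z.2).
    split; first exact: measurableT_comp bv.1 measurable_snd.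
    by have [N HN] := bv.2; exists N => z; exact: HN.
  rewrite -(RintegralB_bounded gT b1 b2).
  have := @le_integral_mdist g _ k k0 (bounded_measurableB b1 b2).
  apply => z.
  by apply: le_trans (vK _ _) _; rewrite ler_wpM2r// mdist_ge0.
apply/ler_addgt0Pl => e e0.
pose k := K + e / (`|r| + 1).
have r0 : 0 < `|r| + 1 by rewrite ltr_pwDr.
have ke : 0 < e / (`|r| + 1) by rewrite divr_gt0.
have kK : K <= k by rewrite lerDl ltW.
have k0 : 0 < k by rewrite ltr_wpDl.
apply: le_trans (pos k kK k0) _.
rewrite /k mulrDl addrC lerD2r -mulrA ger_pMr// mulrC ler_pdivrMr// mul1r.
by apply: le_trans (ler_norm _) _; rewrite lerDl.
Qed.

End kantorovich.

(** * Hoelder functions *)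

Section holder.
Context (R : realType) (dX : measure_display) (X : polishType dX R).
Implicit Types (v w : X -> R).

(** The concave function [r |-> r^delta] lies below its tangent at [r0]; after
    rescaling by [r0] this is Young's inequality with exponents [1 / delta] and
    [1 / (1 - delta)]. *)
Lemma powR_tangent (delta r r0 : R) : 0 < delta -> delta <= 1 -> 0 <= r -> 0 < r0 ->
  r `^ delta <= r0 `^ delta * ((1 - delta) + delta * (r / r0)).
Proof.
move=> d0 d1 r_ge0 r0_gt0; have s0 : 0 <= r / r0 by rewrite divr_ge0// ltW.
have -> : r `^ delta = r0 `^ delta * (r / r0) `^ delta.
  by rewrite -powRM// ?ltW// mulrCA divff ?mulr1// gt_eqF.
rewrite ler_wpM2l ?powR_ge0//.
have [->|dn1] := eqVneq delta 1; first by rewrite powRr1//; lra.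
have d1' : 0 < 1 - delta by rewrite subr_gt0 lt_neqAle dn1.
have := @conjugate_powR R ((r / r0) `^ delta) 1 delta^-1 (1 - delta)^-1.
rewrite !invrK -powRrM divff ?gt_eqF// powRr1// powR1 mulr1 mul1r.
rewrite powR_ge0 ler01 !invr_gt0 d0 d1' => /(_ isT isT isT isT).
have -> : delta + (1 - delta) = 1 by ring.
by move=> /(_ erefl); rewrite addrC [_ * delta]mulrC.
Qed.

Lemma powR_small (delta e : R) : 0 < delta -> 0 < e ->
  exists2 r : R, 0 < r & r `^ delta = e.
Proof.
move=> d0 e0; exists (e `^ delta^-1); first exact: powR_gt0.
by rewrite -powRrM mulVf ?gt_eqF// powRr1// ltW.
Qed.

Definition holder (H delta : R) v := forall x y, v x - v y <= H * mdist x y `^ delta.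

Lemma holder_norm H delta v x y : holder H delta v ->
  `|v x - v y| <= H * mdist x y `^ delta.
Proof.
move=> hv; rewrite ler_norml; have := hv x y; have := hv y x.
by rewrite (metric_sym y x); lra.
Qed.

Lemma holder_continuous H delta v : 0 <= H -> 0 < delta -> holder H delta v ->
  continuous v.
Proof.
move=> H0 d0 hv; apply/continuousP_mdist => x e e0.
have [r r0 rE] := powR_small d0 (divr_gt0 e0 (ltr_pwDr ltr01 H0)).
exists r => // y xy; apply: le_lt_trans (holder_norm x y hv) _.
apply: (@le_lt_trans _ _ (H * r `^ delta)).
  by rewrite ler_wpM2l// ge0_ler_powR ?nnegrE ?mdist_ge0 ?ltW.
by rewrite rE mulrCA gtr_pMr// ltr_pdivrMr ?ltr_pwDr// mul1r ltrDl.
Qed.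

Lemma lipschitz_holder K v : (forall x y, v x - v y <= K * mdist x y) <-> holder K 1 v.
Proof.
by split=> h x y; have := h x y; rewrite powRr1// mdist_ge0.
Qed.

(** The infimal convolution [w x = inf_y (v y + K d(x, y))] of [v] with the cone
    of slope [K]. *)
Lemma lipschitz_minorant v (K C : R) : 0 <= K -> bounded_measurable v ->
  (forall x y, v x - v y <= K * mdist x y + C) ->
  exists w, [/\ bounded_measurable w, forall x y, w x - w y <= K * mdist x y,
    forall x, 0 <= v x - w x & forall x, v x - w x <= C].
Proof.
move=> K0 [mv [N vN]] vC.
pose w x := inf [set v y + K * mdist x y | y in [set: X]].
have X0 : [set: X] !=set0 by exists point.
have lb x y : - N <= v y + K * mdist x y.
  have : 0 <= K * mdist x y by rewrite mulr_ge0// mdist_ge0.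
  by have := vN y; rewrite ler_norml; lra.
have wle x y : w x <= v y + K * mdist x y.
  by apply: ge_inf; [exists (- N) => _ [z _ <-] | exists y].
have wv x : w x <= v x by have := wle x x; rewrite mdistxx mulr0 addr0.
have lip x y : w x - w y <= K * mdist x y.
  rewrite lerBlDl; apply: (inf_image_le X0) => z _; first exact: lb.
  rewrite -addrA lerD2l -mulrDr ler_wpM2l// addrC; exact: metric_triangle.
exists w; split => //.
- split; first exact/measurable_continuous/(holder_continuous K0 ltr01)/lipschitz_holder.
  exists N => x; rewrite ler_norml; apply/andP; split.
    by apply: lb_le_inf; [exists (v x + K * mdist x x), x | move=> _ [z _ <-]].
  by apply: le_trans (wv x) _; have := vN x; rewrite ler_norml => /andP[].
- by move=> x; rewrite subr_ge0.
- move=> x; rewrite lerBlDr -lerBlDl; apply: lb_le_inf.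
    by exists (v x + K * mdist x x), x.
  by move=> _ [y _ <-]; have := vC x y; lra.
Qed.

End holder.

Section minorized_holder.
Context (R : realType) (dX dU : measure_display)
  (X : polishType dX R) (U : polishType dU R) (T : R.-pker (X * U) ~> X)
  (nu : {measure set X -> \bar R}) (minor : minorization T nu).

(** The bound that Jensen's inequality for [r |-> r^delta] gives on a coupling of
    [T z - nu] and [T z' - nu], of mass [kappa] and cost [W]; such a coupling
    exists by Kantorovich duality, but the proof follows the dual side.  With [w] the Lipschitz minorant of [v], the difference of the
    integrals of [w] is controlled by the distance [W] of [T z] and [T z'], while
    [v - w] has values in [0, C] and sees only the residual mass. *)
Lemma minorized_mean_holder (H delta W : R) v z z' : 0 < residual_mass nu ->
  0 <= H -> 0 < delta -> delta <= 1 -> bounded_measurable v -> holder H delta v ->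
  0 <= W -> (wasserstein1 (T z) (T z') <= W%:E)%E ->
  \int[T z]_y v y - \int[T z']_y v y <=
    residual_mass nu * H * (W / residual_mass nu) `^ delta.
Proof.
move=> k0 H0 d0 d1 bv hv W0 WE; set k := residual_mass nu in k0 *.
(* [K] and [C] are the slope and the intercept of the tangent to [H r^delta]; at
   [r = W / kappa] the bound is the claimed one. *)
have pos (r : R) : 0 < r -> W <= k * r ->
    \int[T z]_y v y - \int[T z']_y v y <= k * H * r `^ delta.
  move=> r0 Wr; pose K := H * delta * r `^ delta / r.
  have K0 : 0 <= K by rewrite !mulr_ge0 ?powR_ge0 ?invr_ge0 ?(ltW r0) ?(ltW d0).
  pose C := H * (1 - delta) * r `^ delta.
  have vC x y : v x - v y <= K * mdist x y + C.
    apply: le_trans (hv x y) _.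
    have := powR_tangent d0 d1 (mdist_ge0 x y) r0.
    move=> /(ler_wpM2l H0) /le_trans; apply; rewrite /K /C.
    by rewrite le_eqVlt; apply/orP; left; apply/eqP; ring.
  have [w [bw wlip wv0 wvC]] := lipschitz_minorant K0 bv vC.
  have := Rintegral_sub_le_wasserstein1 K0 bw wlip WE.
  have bvw := bounded_measurableB bv bw.
  have := minorized_mean_ge0 minor z' bvw wv0.
  have := minorized_mean_le minor z bvw wvC.
  rewrite !(minorized_meanB minor) // /minorized_mean -/k => hC h0 hK.
  have {}hK : \int[T z]_y w y - \int[T z']_y w y <= K * (k * r).
    by apply: le_trans hK _; exact: ler_wpM2l.
  have -> : k * H * r `^ delta = K * (k * r) + k * C.
    by rewrite /K /C; field; rewrite gt_eqF.
  lra.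
(* For [W = 0] the tangent point degenerates and is replaced with arbitrarily
   small [r]. *)
have [WE0|Wn0] := eqVneq W 0; last first.
  by apply: pos; [rewrite divr_gt0// lt_neqAle eq_sym Wn0|rewrite mulrC divfK// gt_eqF].
rewrite WE0 mul0r powR0 ?gt_eqF// mulr0; apply/ler_addgt0Pl => e e0; rewrite addr0.
have kH : 0 < k * H + 1 by rewrite ltr_pwDr// mulr_ge0// ltW.
have [r r0 rE] := powR_small d0 (divr_gt0 e0 kH).
apply: le_trans (pos r r0 _) _; first by rewrite WE0 mulr_ge0// ltW.
by rewrite rE mulrCA ger_pMr// ler_pdivrMr// mul1r lerDl.
Qed.

End minorized_holder.

(** * Lipschitz models *)

Section lipschitz.
Context (R : realType) (dX dU : measure_display)
  (X : polishType dX R) (U : polishType dU R) (T : R.-pker (X * U) ~> X)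
  (c : X * U -> R) (mc : measurable_fun [set: X * U] c).
Implicit Types (v : X -> R) (L : set U) (Kc KT : R).

Lemma wasserstein1_ge0 (mu mu' : {measure set X -> \bar R}) :
  (0 <= wasserstein1 mu mu')%E.
Proof.
apply: le_ereal_inf_tmp => _ [g _ <-]; apply: integral_ge0 => z _.
by rewrite lee_fin mdist_ge0.
Qed.

(** The constants of a Lipschitz condition may be negative when the spaces are
    trivial; existence of the optimal costs is proved with their positive parts. *)
Lemma lipschitz_condition_max0 Kc KT : lipschitz_condition T c Kc KT ->
  lipschitz_condition T c (Num.max 0 Kc) (Num.max 0 KT).
Proof.
move=> [cX cU cL TL]; split => // x x' u u'.
  apply: le_trans (cL x x' u u') _; rewrite ler_wpM2r ?addr_ge0 ?mdist_ge0//.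
  by rewrite le_max lexx orbT.
apply: le_trans (TL x x' u u') _; rewrite lee_fin ler_wpM2r ?addr_ge0 ?mdist_ge0//.
by rewrite le_max lexx orbT.
Qed.

(** Two distinct actions are at positive distance, which forces nonnegative
    constants; otherwise there is a single action. *)
Lemma lipschitz_condition_ge0 Kc KT : lipschitz_condition T c Kc KT ->
  (0 <= Kc /\ 0 <= KT) \/ (forall u u' : U, u = u').
Proof.
move=> [_ _ cL TL].
have [?|/existsNP[u /existsNP[u' uu']]] := pselect (forall u u' : U, u = u').
  by right.
have d0 : 0 < mdist (point : X) point + mdist u u'.
  by rewrite mdistxx add0r mdist_gt0; apply/eqP.
left; split; rewrite -(pmulr_lge0 _ d0).
  exact: le_trans (normr_ge0 _) (cL _ _ _ _).
by rewrite -lee_fin; exact: le_trans (wasserstein1_ge0 _ _) (TL _ _ _ _).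
Qed.

Lemma lipschitz_cost_bounded Kc KT : 0 <= Kc -> lipschitz_condition T c Kc KT ->
  bounded_measurable c.
Proof.
move=> Kc0 [cX cU cL _]; split => //.
have [D HD] := compact_mdist_bounded cX; have [D' HD'] := compact_mdist_bounded cU.
pose z0 : X * U := (point, point).
exists (`|c z0| + Kc * (D + D')) => -[x u].
have -> : c (x, u) = c z0 + (c (x, u) - c z0) by ring.
apply: le_trans (ler_normD _ _) _; rewrite lerD2l.
apply: le_trans (cL _ _ _ _) _; rewrite ler_wpM2l// lerD//.
Qed.

Lemma lipschitz_mean Kc KT K v x x' u u' : lipschitz_condition T c Kc KT ->
  0 <= K -> bounded_measurable v -> (forall x y, v x - v y <= K * mdist x y) ->
  `|\int[T (x, u)]_y v y - \int[T (x', u')]_y v y| <=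
    K * KT * (mdist x x' + mdist u u').
Proof.
move=> [_ _ _ TL] K0 bv vK.
have := Rintegral_sub_le_wasserstein1 K0 bv vK (TL x x' u u').
have := Rintegral_sub_le_wasserstein1 K0 bv vK (TL x' x u' u).
by rewrite (metric_sym x' x) (metric_sym u' u) ler_norml -mulrA; lra.
Qed.

Lemma lipschitz_action_value Kc KT K v x x' u u' : lipschitz_condition T c Kc KT ->
  0 <= K -> bounded_measurable v -> (forall x y, v x - v y <= K * mdist x y) ->
  `|action_value T c v (x, u) - action_value T c v (x', u')| <=
    (Kc + K * KT) * (mdist x x' + mdist u u').
Proof.
move=> lip K0 bv vK; have := lipschitz_mean x x' u u' lip K0 bv vK.
case: lip => _ _ /(_ x x' u u') cL _; rewrite mulrDl /action_value.
by move: cL; rewrite !ler_norml; lra.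
Qed.

Lemma lipschitz_uniformly_continuous (g : X * U -> R) (K : R) :
  (forall x x' u u', `|g (x, u) - g (x', u')| <= K * (mdist x x' + mdist u u')) ->
  uniformly_continuous_mdist2 g.
Proof.
move=> gK e e0; have K1 : 0 < `|K| + 1 by rewrite ltr_pwDr.
have d0 : 0 < e / (`|K| + 1) by rewrite divr_gt0.
exists (e / (`|K| + 1) / 2) => [|x u x' u' xx uu]; first by rewrite divr_gt0.
apply: le_lt_trans (gK _ _ _ _) _.
apply: (@le_lt_trans _ _ (`|K| * (e / (`|K| + 1)))).
  apply: (@le_trans _ _ (`|K| * (mdist x x' + mdist u u'))).
    by rewrite ler_wpM2r ?addr_ge0 ?mdist_ge0// ler_norm.
  by rewrite ler_wpM2l//; lra.
by rewrite mulrCA gtr_pMr// ltr_pdivrMr// mul1r ltrDl.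
Qed.

Lemma lipschitz_bounded_measurable K v : compact [set: X] -> 0 <= K ->
  (forall x y, v x - v y <= K * mdist x y) -> bounded_measurable v.
Proof.
move=> cX K0 /lipschitz_holder hv.
exact: compact_bounded_measurable (holder_continuous K0 ltr01 hv).
Qed.

(** The class of [K]-Lipschitz functions with [K = Kc / (1 - KT)] is preserved by
    the Bellman operator of [(1 - eta) T] for every [eta].  The fixed point itself
    blows up like [1 / eta], but its oscillation is at most [K D], so recentring
    it at a point yields an approximate solution with [rho = eta * v0]. *)
Lemma contracting_approx_optimality Kc KT L (e : R) :
  lipschitz_condition T c Kc KT -> 0 <= Kc -> 0 <= KT -> KT < 1 ->
  L !=set0 -> 0 < e -> exists rho v, approx_optimality T c L e rho v /\
    forall x x' u u', `|action_value T c v (x, u) - action_value T c v (x', u')| <=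
      Kc / (1 - KT) * (mdist x x' + mdist u u').
Proof.
move=> lip Kc0 KT0 KT1 L0 e0; have [cX cU cL TL] := lip.
have bc := lipschitz_cost_bounded Kc0 lip.
have [D HD] := compact_mdist_bounded cX.
have D0 : 0 <= D by exact: le_trans (mdist_ge0 _ _) (HD point point).
pose K := Kc / (1 - KT).
have K0 : 0 <= K by rewrite divr_ge0// subr_ge0 ltW.
have KE : Kc + K * KT = K by rewrite /K; field; rewrite subr_eq0 gt_eqF.
have KD : 0 < K * D + 1 by rewrite ltr_pwDr// mulr_ge0.
(* Small enough for the discounting error [eta * (K * D)] to be at most [e / 2]. *)
pose eta := Num.min 1 (e / 2 / (K * D + 1)).
have eta0 : 0 < eta by rewrite /eta lt_min ltr01 !divr_gt0.
have eta1 : eta <= 1 by rewrite /eta ge_min lexx.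
have etaKD : eta * (K * D) <= e / 2.
  apply: (@le_trans _ _ (e / 2 / (K * D + 1) * (K * D))).
    apply: ler_wpM2r; first exact: mulr_ge0.
    by rewrite /eta ge_min lexx orbT.
  by rewrite mulrAC ler_pdivrMr// ler_wpM2l ?lerDl ?divr_ge0// ltW.
pose b := 1 - eta.
have b0 : 0 <= b by rewrite subr_ge0.
have b1 : b < 1 by rewrite /b; lra.
pose F : set (X -> R) := [set v | forall x y, v x - v y <= K * mdist x y].
pose E v (z : X * U) : R := b * \int[T z]_y v y.
have bF v : F v -> bounded_measurable v by exact: lipschitz_bounded_measurable.
have [M cM] := bc.2; have e20 : 0 < e / 2 by rewrite divr_gt0.
have F0 : F (fun=> 0) by move=> x y; rewrite subrr mulr_ge0// mdist_ge0.
have meanB v w (a : R) z : bounded_measurable v -> bounded_measurable w ->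
    (forall y, v y <= w y + a) -> \int[T z]_y v y <= \int[T z]_y w y + a.
  move=> bv bw vw; rewrite -(Rintegral_Dcst (prob_kernel z) a bw).
  apply: (le_Rintegral_bounded (kernel_mass_lty T z) bv) => //.
  by apply: bounded_measurableD => //; exact: bounded_measurable_cst.
have E_contract v w (a : R) : F v -> F w -> (forall y, `|v y - w y| <= a) ->
    forall z, `|E v z - E w z| <= b * a.
  move=> /bF bv /bF bw vw z; rewrite /E -mulrBr normrM ger0_norm// ler_wpM2l//.
  have vw1 : \int[T z]_y v y <= \int[T z]_y w y + a.
    by apply: meanB => // y; have := vw y; rewrite ler_norml; lra.
  have wv1 : \int[T z]_y w y <= \int[T z]_y v y + a.
    by apply: meanB => // y; have := vw y; rewrite ler_norml; lra.
  by rewrite ler_norml; lra.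
have F_bellman v : F v -> F (bellman L c E v).
  move=> Fv x y; have bv := bF v Fv; apply: le_trans (ler_norm _) _.
  have [N EN] := (bounded_measurable_action_value T bc bv).2.
  apply: (@bellman_modulus _ _ _ _ _ _ _ (M + b * (N + M))) => // [z|u].
    apply: le_trans (ler_normD _ _) _; apply: lerD => //.
    rewrite /E normrM ger0_norm// ler_wpM2l//.
    have -> : \int[T z]_y v y = action_value T c v z - c z.
      by rewrite /action_value addrAC subrr add0r.
    by apply: le_trans (ler_normB _ _) _; exact: lerD.
  have := lipschitz_mean x y u u lip K0 bv Fv; rewrite mdistxx addr0.
  have := cL x y u u; rewrite mdistxx addr0 -{2}KE mulrDl => h1 h2.
  have -> : c (x, u) + E v (x, u) - (c (y, u) + E v (y, u)) =
      c (x, u) - c (y, u) + b * (\int[T (x, u)]_y v y - \int[T (y, u)]_y v y).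
    by rewrite /E; ring.
  apply: le_trans (ler_normD _ _) _; apply: lerD => //.
  rewrite normrM ger0_norm//; apply: le_trans h2.
  by rewrite ler_piMl// ltW.
have [||v Fv [lo hi]] := value_iteration L0 cM b0 b1 F0 F_bellman _ _ E_contract e20.
- by move=> v /bF[].
- by move=> z; rewrite /E Rintegral_cst// mul0r mulr0.
pose v0 := v point; pose w x := v x - v0.
have bv := bF v Fv.
have Fw : F w by move=> x y; have := Fv x y; rewrite /w; lra.
have bw := bF w Fw.
have QE z : action_value T c w z = c z + E v z + eta * \int[T z]_y w y - b * v0.
  have wE : \int[T z]_y w y = \int[T z]_y v y - v0.
    exact: (Rintegral_Dcst (prob_kernel z) (- v0) bv).
  by rewrite /action_value wE /E /b; ring.
have wKD y : `|w y| <= K * D.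
  apply: le_trans (_ : K * mdist y point <= _); last exact: ler_wpM2l.
  rewrite ler_norml; have := Fv y point; have := Fv point y.
  by rewrite (metric_sym point y) /w /v0; lra.
have wint z : `|eta * \int[T z]_y w y| <= e / 2.
  rewrite normrM (gtr0_norm eta0); apply: le_trans etaKD.
  apply: ler_wpM2l; first exact: ltW.
  have b0c := bounded_measurable_cst X (0 : R).
  have z0 : \int[T z]_y (0 : R) = 0 by rewrite Rintegral_cst// mul0r.
  have w1 : \int[T z]_y w y <= \int[T z]_y (0 : R) + K * D.
    by apply: meanB => // y; have := wKD y; rewrite ler_norml; lra.
  have w2 : \int[T z]_y (0 : R) <= \int[T z]_y w y + K * D.
    by apply: meanB => // y; have := wKD y; rewrite ler_norml; lra.
  by rewrite ler_norml; lra.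
exists (eta * v0), w; split; first split => //.
- move=> x u Lu; rewrite QE; have := lo x u Lu; have := wint (x, u).
  by rewrite ler_norml /w /b; lra.
- move=> x; have [u Lu hu] := hi x; exists u => //; rewrite QE; have := wint (x, u).
  by rewrite ler_norml /w /b; lra.
by move=> x x' u u'; rewrite -/K -KE; exact: lipschitz_action_value.
Qed.

End lipschitz.

Section minorized_lipschitz.
Context (R : realType) (dX dU : measure_display)
  (X : polishType dX R) (U : polishType dU R) (T : R.-pker (X * U) ~> X)
  (c : X * U -> R) (mc : measurable_fun [set: X * U] c).
Implicit Types (v : X -> R) (L : set U) (Kc KT : R).

(** The Lipschitz constants of the iterates may grow without bound when
    [1 <= KT]; it suffices here that every iterate has one. *)
Lemma minorized_lipschitz_approx_optimality nu Kc KT L (e : R) :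
  minorization T nu -> lipschitz_condition T c Kc KT -> 0 <= Kc -> 0 <= KT ->
  L !=set0 -> 0 < e -> exists rho v, approx_optimality T c L e rho v /\
    uniformly_continuous_mdist2 (action_value T c v).
Proof.
move=> minor lip Kc0 KT0 L0 e0; have [cX cU cL TL] := lip.
have bc := lipschitz_cost_bounded mc Kc0 lip.
pose F : set (X -> R) :=
  [set v | exists2 K : R, 0 <= K & forall x y, v x - v y <= K * mdist x y].
have bF v : F v -> bounded_measurable v.
  by move=> [K K0 Kv]; exact: lipschitz_bounded_measurable Kv.
have [||||rho [v [opt Fv]]] := @minorized_approx_optimality _ _ _ _ _ _ _ minor
    _ bc L F e L0.
- by exists 0 => // x y; rewrite subrr mul0r.
- exact: bF.
- move=> v Fv; have bv := bF v Fv; have [K K0 Kv] := Fv.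
  exists (Kc + K * KT) => [|x y]; first by rewrite addr_ge0 ?mulr_ge0.
  have [N QN] := (bounded_measurableD (bounded_measurable_action_value T bc bv)
      (bounded_measurable_cst _ (- \int[nu]_y v y))).2.
  have cE z : c z + minorized_mean T nu v z = action_value T c v z - \int[nu]_y v y.
    by rewrite (action_value_minorized T nu); ring.
  apply: le_trans (ler_norm _) _; apply: (bellman_modulus (B := N) L0) => [z|u].
    by rewrite cE.
  have := lipschitz_action_value x y u u lip K0 bv Kv; rewrite mdistxx addr0.
  by rewrite !cE opprB addrA subrK.
- exact: e0.
exists rho, v; split => //; have [K K0 Kv] := Fv.
apply: lipschitz_uniformly_continuous => x x' u u'.
exact: (lipschitz_action_value x x' u u' lip K0 (bF v Fv) Kv).
Qed.

(** The hypothesis on [KT] is exactly [kappa^(1 - delta) * KT^delta < 1]. *)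
Lemma holder_rate_lt1 (k KT delta : R) : 0 < k -> 0 <= KT -> 0 < delta ->
  KT < k^-1 `^ ((1 - delta) / delta) -> k * (KT / k) `^ delta < 1.
Proof.
move=> k0 KT0 d0 KTk.
have kV0 : 0 <= k^-1 by rewrite invr_ge0 ltW.
have : KT `^ delta < k^-1 `^ (1 - delta).
  have := gt0_ltr_powR d0 KT0 (powR_ge0 _ _) KTk.
  by rewrite -powRrM divfK// gt_eqF.
rewrite powRM// -(@ltr_pM2r _ (k^-1 `^ delta)) ?powR_gt0 ?invr_gt0//.
rewrite -powRD; last by rewrite invr_eq0 (gt_eqF k0) implybT.
by rewrite subrK powRr1// -(ltr_pM2l k0) mulfV// gt_eqF.
Qed.

(** [H] is the constant that the Bellman operator preserves: one step turns it
    into [Kc * M `^ (1 - delta) + theta * H = H], where the first term converts a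
    Lipschitz bound on distances at most [M] into a Hoelder bound. *)
Lemma minorized_holder_approx_optimality nu Kc KT (M delta : R) L (e : R) :
  minorization T nu -> lipschitz_condition T c Kc KT -> 0 <= Kc -> 0 <= KT ->
  0 < residual_mass nu -> 0 < delta -> delta <= 1 -> diameter X <= M ->
  let theta := residual_mass nu * (KT / residual_mass nu) `^ delta in theta < 1 ->
  let H := Kc * M `^ (1 - delta) / (1 - theta) in
  L !=set0 -> 0 < e -> exists rho v, approx_optimality T c L e rho v /\
    forall x u u', mdist u u' <= M ->
      `|action_value T c v (x, u) - action_value T c v (x, u')| <=
        H * mdist u u' `^ delta.
Proof.
move=> minor lip Kc0 KT0 k0 d0 d1 DM theta th1 H L0 e0; have [cX cU cL TL] := lip.
have bc := lipschitz_cost_bounded mc Kc0 lip.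
have th : 0 < 1 - theta by rewrite subr_gt0.
have H0 : 0 <= H by rewrite divr_ge0 ?mulr_ge0 ?powR_ge0// ltW.
have HE : Kc * M `^ (1 - delta) + H * theta = H.
  by rewrite /H; field; rewrite gt_eqF.
have bF v : holder H delta v -> bounded_measurable v.
  by move=> hv; exact: compact_bounded_measurable (holder_continuous H0 d0 hv).
have d_ge0 : 0 <= delta by exact: ltW.
have powM (d : R) : 0 <= d -> d <= M -> d <= M `^ (1 - delta) * d `^ delta.
  rewrite le_eqVlt => /predU1P[<-|dpos] dM.
    by rewrite mulr_ge0 ?powR_ge0.
  rewrite -{1}(powRr1 (ltW dpos)) -{1}(subrK delta 1) powRD; last first.
    by rewrite (gt_eqF dpos) implybT.
  rewrite ler_wpM2r ?powR_ge0// ge0_ler_powR ?nnegrE ?subr_ge0// ?(ltW dpos)//.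
  exact: le_trans (ltW dpos) dM.
have mean v x x' u u' : holder H delta v ->
    `|\int[T (x, u)]_y v y - \int[T (x', u')]_y v y| <=
      H * theta * (mdist x x' + mdist u u') `^ delta.
  move=> hv; set r := mdist x x' + mdist u u'.
  have r0 : 0 <= r by rewrite addr_ge0// mdist_ge0.
  have rE : residual_mass nu * H * (KT * r / residual_mass nu) `^ delta =
      H * theta * r `^ delta.
    by rewrite [KT * r / _]mulrAC powRM ?divr_ge0 ?(ltW k0)// /theta; ring.
  have W0 : 0 <= KT * r by rewrite mulr_ge0.
  have := minorized_mean_holder minor k0 H0 d0 d1 (bF v hv) hv W0 (TL x x' u u').
  have W' := TL x' x u' u; rewrite (metric_sym x' x) (metric_sym u' u) in W'.
  have := minorized_mean_holder minor k0 H0 d0 d1 (bF v hv) hv W0 W'.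
  by rewrite rE ler_norml; lra.
have Qx v x x' u u' : holder H delta v -> mdist x x' + mdist u u' <= M ->
    `|action_value T c v (x, u) - action_value T c v (x', u')| <=
      H * (mdist x x' + mdist u u') `^ delta.
  move=> hv; have := mean v x x' u u' hv; have := cL x x' u u'.
  set r := mdist x x' + mdist u u' => h1 h2 rM.
  have r0 : 0 <= r by rewrite addr_ge0// mdist_ge0.
  have := ler_wpM2l Kc0 (powM r r0 rM); rewrite mulrA => h3.
  rewrite -[X in X * _]HE mulrDl /action_value.
  by move: h1 h2 h3; rewrite !ler_norml; lra.
have [||||rho [v [opt hv]]] := @minorized_approx_optimality _ _ _ _ _ _ _ minor
    _ bc L (holder H delta) e L0.
- by move=> x y; rewrite subrr mulr_ge0// powR_ge0.
- exact: bF.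
- move=> v hv x y; have bv := bF v hv.
  have [N QN] := (bounded_measurableD (bounded_measurable_action_value T bc bv)
      (bounded_measurable_cst _ (- \int[nu]_y v y))).2.
  have cE z : c z + minorized_mean T nu v z = action_value T c v z - \int[nu]_y v y.
    by rewrite (action_value_minorized T nu); ring.
  apply: le_trans (ler_norm _) _; apply: (bellman_modulus (B := N) L0) => [z|u].
    by rewrite cE.
  have := Qx v x y u u hv; rewrite mdistxx addr0 => Qxy.
  rewrite !cE opprB addrA subrK; apply: Qxy.
  exact: le_trans (mdist_le_diameter x y cX) DM.
- exact: e0.
exists rho, v; split => // x u u' uM.
by have := Qx v x x u u' hv; rewrite mdistxx add0r; apply.
Qed.

End minorized_lipschitz.

(** * Loss from restricting to finitely many actions *)

Section lipschitz_value_gaps.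
Context (R : realType) (dX dU : measure_display)
  (X : polishType dX R) (U : polishType dU R) (T : R.-pker (X * U) ~> X)
  (c : X * U -> R) (mc : measurable_fun [set: X * U] c)
  (L : set U) (fL : finite_set L) (L0 : L !=set0).

(** The degenerate case in which the Lipschitz constants carry no sign. *)
Lemma single_action_gap rhoU rhoL : compact [set: U] -> (forall u u' : U, u = u') ->
  is_optimal_cost T c [set: U] rhoU -> is_optimal_cost T c L rhoL ->
  rhoL - rhoU = 0 /\ covering_radius L = 0.
Proof.
move=> cU uu optU optL; have [u0 Lu0] := L0.
have LT : L = [set: U] by apply/seteqP; split => // u _; rewrite (uu u u0).
split.
  apply/eqP; rewrite subr_eq0; apply/eqP.
  by have := optL point; rewrite LT optU => -[].
apply/eqP; rewrite eq_le covering_radius_ge0// andbT.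
apply: sup_le_ub; first by exists (inf [set mdist u0 v | v in L]), u0.
move=> _ [u _ <-]; apply: ge_inf.
  by exists 0 => _ [v _ <-]; exact: mdist_ge0.
by exists u0 => //; rewrite (uu u u0) mdistxx.
Qed.

(** The action values of the approximate solution are [K]-Lipschitz in the action
    with [K = Kc / (1 - KT)]. *)
Lemma contracting_gap Kc KT : lipschitz_condition T c Kc KT -> KT < 1 ->
  exists rhoU rhoL : R,
    [/\ is_optimal_cost T c [set: U] rhoU,
        is_optimal_cost T c L rhoL &
        rhoL - rhoU <= Kc / (1 - KT) * covering_radius L].
Proof.
move=> lip KT1; have [cX cU _ _] := lip.
have lip0 := lipschitz_condition_max0 lip.
have Kc0 : 0 <= Num.max 0 Kc by rewrite le_max lexx.
have KT0 : 0 <= Num.max 0 KT by rewrite le_max lexx.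
have KT01 : Num.max 0 KT < 1 by rewrite gt_max ltr01.
have bc := lipschitz_cost_bounded mc Kc0 lip0.
have ex A : A !=set0 -> measurable A -> has_finite_nets A ->
    exists r, is_optimal_cost T c A r.
  move=> A0 mA netA; apply: (approx_optimality_is_optimal_cost bc mA netA) => e e0.
  have [rho [v [opt Qv]]] := contracting_approx_optimality mc lip0 Kc0 KT0 KT01 A0 e0.
  by exists rho, v; split => //; exact: lipschitz_uniformly_continuous Qv.
have UT0 : [set: U] !=set0 by exists point.
have [rhoU optU] := ex _ UT0 measurableT (compact_has_finite_nets cU).
have [rhoL optL] := ex _ L0 (measurable_finite_set fL) (finite_has_finite_nets fL).
exists rhoU, rhoL; split => //.
have [[Kc_ge0 KT_ge0]|uu] := lipschitz_condition_ge0 lip; last first.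
  by have [-> ->] := single_action_gap cU uu optU optL; rewrite mulr0.
apply: (approx_optimality_gap bc fL optU optL) => e e0.
have [rho [v [opt Qv]]] :=
  contracting_approx_optimality mc lip Kc_ge0 KT_ge0 KT1 UT0 e0.
exists rho, v; split => // y u.
have [u' Lu' uu'] := covering_radius_attained cU fL L0 u.
exists u' => //; have := Qv y y u u'; rewrite mdistxx add0r.
have /ler_wpM2l/(_ _ _ uu') : 0 <= Kc / (1 - KT) by rewrite divr_ge0// subr_ge0 ltW.
by rewrite ler_norml; lra.
Qed.

(** The optimal costs are found before [delta] is known; each [delta] then brings
    its own approximate solutions for [U], with the Hoelder constant that gives
    the bound. *)
Lemma minorized_lipschitz_gap nu Kc KT :
  minorization T nu -> 0 < residual_mass nu -> lipschitz_condition T c Kc KT ->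
  exists rhoU rhoL : R,
    [/\ is_optimal_cost T c [set: U] rhoU,
        is_optimal_cost T c L rhoL &
        forall delta : R, 0 < delta -> delta <= 1 ->
          KT < (residual_mass nu)^-1 `^ ((1 - delta) / delta) ->
          rhoL - rhoU <=
            Kc * Num.max (diameter X) (covering_radius L) `^ (1 - delta)
              / (1 - residual_mass nu * (KT / residual_mass nu) `^ delta)
              * covering_radius L `^ delta].
Proof.
move=> minor k0 lip; have [cX cU _ _] := lip.
have lip0 := lipschitz_condition_max0 lip.
have Kc0 : 0 <= Num.max 0 Kc by rewrite le_max lexx.
have KT0 : 0 <= Num.max 0 KT by rewrite le_max lexx.
have bc := lipschitz_cost_bounded mc Kc0 lip0.
have ex A : A !=set0 -> measurable A -> has_finite_nets A ->
    exists r, is_optimal_cost T c A r.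
  move=> A0 mA netA; apply: (approx_optimality_is_optimal_cost bc mA netA) => e e0.
  exact: minorized_lipschitz_approx_optimality minor lip0 Kc0 KT0 A0 e0.
have UT0 : [set: U] !=set0 by exists point.
have [rhoU optU] := ex _ UT0 measurableT (compact_has_finite_nets cU).
have [rhoL optL] := ex _ L0 (measurable_finite_set fL) (finite_has_finite_nets fL).
exists rhoU, rhoL; split => // delta d0 d1 KTk.
have [[Kc_ge0 KT_ge0]|uu] := lipschitz_condition_ge0 lip; last first.
  have [-> ->] := single_action_gap cU uu optU optL.
  by rewrite powR0 ?gt_eqF// mulr0.
set M := Num.max _ _.
have DM : diameter X <= M by rewrite /M le_max lexx.
have rM : covering_radius L <= M by rewrite /M le_max lexx orbT.
have th1 := holder_rate_lt1 k0 KT_ge0 d0 KTk.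
apply: (approx_optimality_gap bc fL optU optL) => e e0.
have [rho [v [opt Qv]]] := minorized_holder_approx_optimality mc minor lip
  Kc_ge0 KT_ge0 k0 d0 d1 DM th1 UT0 e0.
exists rho, v; split => // y u.
have [u' Lu' uu'] := covering_radius_attained cU fL L0 u.
exists u' => //; have := Qv y u u' (le_trans uu' rM).
have H0 : 0 <= Kc * M `^ (1 - delta) /
    (1 - residual_mass nu * (KT / residual_mass nu) `^ delta).
  by rewrite divr_ge0 ?mulr_ge0 ?powR_ge0// subr_ge0 ltW.
have uud : mdist u u' `^ delta <= covering_radius L `^ delta.
  apply: ge0_ler_powR uu' => //; rewrite ?nnegrE ?mdist_ge0 ?(ltW d0)//.
  exact: covering_radius_ge0 cU fL L0.
have := ler_wpM2l H0 uud.
by rewrite ler_norml; lra.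
Qed.

End lipschitz_value_gaps.

Theorem theorem5 (R : realType) (dX dU : measure_display)
    (X : polishType dX R) (U : polishType dU R)
    (T : R.-pker (X * U) ~> X) (c : X * U -> R)
    (mc : measurable_fun [set: X * U] c) :
  [/\ (forall nu : {measure set X -> \bar R},
         minorization T nu -> 0 < 1 - fine (nu setT) ->
         weak_continuity T c ->
         exists (rhoU : R) (rho : set U -> R),
           [/\ is_optimal_cost T c [set: U] rhoU,
               (forall L : set U, finite_set L -> L !=set0 ->
                  is_optimal_cost T c L (rho L)) &
               forall e : R, 0 < e -> exists2 d : R, 0 < d &
                 forall L : set U, finite_set L -> L !=set0 ->
                   covering_radius L < d -> `|rho L - rhoU| < e]),
      (forall (Kc KT : R) (L : set U), finite_set L -> L !=set0 ->
         lipschitz_condition T c Kc KT -> KT < 1 ->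
         exists rhoU rhoL : R,
           [/\ is_optimal_cost T c [set: U] rhoU,
               is_optimal_cost T c L rhoL &
               rhoL - rhoU <= Kc / (1 - KT) * covering_radius L]) &
      (forall (nu : {measure set X -> \bar R}) (Kc KT : R) (L : set U),
         finite_set L -> L !=set0 ->
         minorization T nu ->
         let kappa := 1 - fine (nu setT) in 0 < kappa ->
         lipschitz_condition T c Kc KT ->
         exists rhoU rhoL : R,
           [/\ is_optimal_cost T c [set: U] rhoU,
               is_optimal_cost T c L rhoL &
               forall delta : R, 0 < delta -> delta <= 1 ->
                 KT < kappa^-1 `^ ((1 - delta) / delta) ->
                 rhoL - rhoU <=
                   Kc * Num.max (diameter X) (covering_radius L)
                          `^ (1 - delta)
                     / (1 - kappa * (KT / kappa) `^ delta)
                     * covering_radius L `^ delta])].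
Proof.
split.
- by move=> nu minor _ wc; exact: minorized_finite_actions_converge minor wc.
- by move=> Kc KT L fL L0 lip KT1; exact: contracting_gap lip KT1.
- by move=> nu Kc KT L fL L0 minor k k0 lip; exact: minorized_lipschitz_gap minor k0 lip.
Qed.
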